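(* Let $\Gamma$ be a countable amenable group with a probability measure preserving action on $(X,\mu)$. Let $\tilde\Phi: \Gamma \to 2^\Gamma$ be an invariant random past on $\Gamma$, and let $\Phi = \tilde\Phi(1_\Gamma)\subset\Gamma$. Let $\alpha$ be a countable Borel partition of $X$ with $H_\mu(\alpha) < +\infty$ and let $\mathcal{A}$ be a $\Gamma$-invariant $\sigma$-subalgebra of the Borel $\sigma$-algebra of $X$. Then $$h_\Gamma(\alpha, X, \mu \mid \mathcal{A}) = \mathbb{E}_{\tilde\Phi}\, H_\mu(\alpha \mid \alpha^{\Phi} \vee \mathcal{A}).$$
   Context: $\Gamma$ acts on the left by homeomorphisms on a compact metric space $X$ preserving the Borel probability measure $\mu$. $H_\mu(\alpha)$ is Shannon entropy, and for a $\sigma$-subalgebra $\mathcal B$, $H_\mu(\alpha\mid\mathcal{B}) = -\int \log\mu(\alpha\mid\mathcal{B})\,d\mu$ is conditional Shannon entropy. For $g\in\Gamma$, $\alpha^g = \{g^{-1}(B): B\in\alpha\}$; for finite $F\subset\Gamma$, $\alpha^F = \bigvee_{g\in F}\alpha^g$; for infinite $F$, $\alpha^F$ is the smallest $\sigma$-algebra containing all $\alpha^g$, $g\in F$. $\vee$ denotes the join of partitions/$\sigma$-algebras. A F&oslash;lner sequence is a sequence $(F_i)$ of nonempty finite subsets of $\Gamma$ with $\lim_i |gF_i\setminus F_i|/|F_i| = 0$ for every $g\in\Gamma$. The Kolmogorov-Sinai entropy of $\alpha$ relative to $\mathcal A$ is $h_\Gamma(\alpha,X,\mu\mid\mathcal{A})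 = \lim_{i\to\infty} H_\mu(\alpha^{F_i}\mid\mathcal{A})/|F_i|$, which does not depend on the F&oslash;lner sequence. An invariant random past on $\Gamma$ is a random function $\tilde\Phi:\Gamma\to 2^\Gamma$ ($2^\Gamma$ being the set of subsets of $\Gamma$ with the product topology), i.e. a Borel probability measure on $(2^\Gamma)^\Gamma$, such that: (i) almost surely, $g\notin\tilde\Phi(g)$ for all $g\in\Gamma$; (ii) almost surely, for all $g,h\in\Gamma$, if $g\in\tilde\Phi(h)$ then $\tilde\Phi(g)\subset\tilde\Phi(h)$; (iii) almost surely, for all $g\neq h$ in $\Gamma$, either $g\in\tilde\Phi(h)$ or $h\in\tilde\Phi(g)$; (iv) for every $g\in\Gamma$ the random subsets $\tilde\Phi(g)$ and $\tilde\Phi(1_\Gamma)g$ have the same distribution. $\mathbb{E}_{\tilde\Phi}$ denotes expectation with respect to the law of $\tilde\Phi$. *)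

(* Defs.v *)
From HB Require Import structures.
From mathcomp Require Import all_boot all_order all_algebra.
From mathcomp Require Import finmap.
From mathcomp Require Import all_classical all_reals all_analysis.
Set Implicit Arguments.
Unset Strict Implicit.
Unset Printing Implicit Defensive.
Import Order.TTheory GRing.Theory Num.Theory.
Import numFieldNormedType.Exports.
Local Open Scope classical_set_scope.
Local Open Scope ring_scope.

(* The library's measurable types are pointed. Asking the metric space to be
   pointed loses nothing here: the spaces considered carry a probability
   measure, so they are nonempty. *)
#[short(type="pointedMetricType")]
HB.structure Definition PointedMetric (R : numDomainType) :=
  {M of Metric R M & isPointed M}.

Notation borel X := (g_sigma_algebraType (@open X)).

Section amenability.
Context (R : realType) (Gam : groupType).

Definition folner (F : nat -> {fset Gam}) : Prop :=
  (forall i, F i != fset0) /\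
  forall g : Gam,
    (fun i => #|` ([fset (g * x)%g | x in F i] `\` F i)%fset|%:R
              / #|` F i|%:R : R) @ \oo --> (0 : R).

Definition amenable : Prop := exists F, folner F.

End amenability.

Definition homeo_action (Gam : groupType) (X : topologicalType)
    (act : Gam -> X -> X) : Prop :=
  [/\ forall x, act 1%g x = x,
      forall g h x, act (g * h)%g x = act g (act h x) &
      forall g, continuous (act g)].

Section entropy.
Context d (T : measurableType d) (R : realType) (mu : probability T R).

Definition countable_partition (alpha : set (set T)) : Prop :=
  [/\ countable alpha, alpha `<=` measurable &
      partition alpha id [set: T]].

Definition shannon_entropy (alpha : set (set T)) : \bar R :=
  (\esum_(A in alpha) (- (fine (mu A) * ln (fine (mu A))))%:E)%E.

(* [f] is a version of the conditional probability of [A] given [B]. *)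
Definition is_cond_prob (B : set (set T)) (A : set T) (f : T -> R) : Prop :=
  [/\ measurable_fun [set: g_sigma_algebraType B] f,
      mu.-integrable [set: T] (EFin \o f) &
      forall C, B C -> (\int[mu]_(x in C) (f x)%:E = mu (A `&` C))%E].

Definition cond_prob (B : set (set T)) (A : set T) : T -> R :=
  xget (cst 0) [set f | is_cond_prob B A f].

(* The union of the cells containing [x]; for a partition, the cell of [x]. *)
Definition cell (alpha : set (set T)) (x : T) : set T :=
  \bigcup_(A in [set A | alpha A /\ A x]) A.

(* [lne] is the logarithm with [lne 0 = -oo]. *)
Definition cond_entropy (alpha : set (set T)) (B : set (set T)) : \bar R :=
  (- \int[mu]_x lne (cond_prob B (cell alpha x) x)%:E)%E.

Context (Gam : groupType).

Definition pmp (act : Gam -> T -> T) : Prop :=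
  forall (g : Gam) (A : set T), measurable A -> mu (act g @^-1` A) = mu A.

Definition invariant_subalgebra (A : set (set T)) (act : Gam -> T -> T) : Prop :=
  [/\ sigma_algebra [set: T] A, A `<=` measurable &
      forall (g : Gam) (B : set T), A B -> A (act g @^-1` B)].

Definition translate (alpha : set (set T)) (act : Gam -> T -> T)
    (g : Gam) : set (set T) :=
  [set act g @^-1` B | B in alpha].

(* The join of the partitions [translate alpha act g], [g] in the finite set [F]:
   that is, the nonempty intersections of one cell from each. *)
Definition join_translates (alpha : set (set T)) (act : Gam -> T -> T)
    (F : {fset Gam}) : set (set T) :=
  [set C | C !=set0 /\
    exists2 c : Gam -> set T,
      forall g, g \in F -> translate alpha act g (c g) &
      C = \bigcap_(g in [set` F]) c g].

(* For finite [F] this is the sigma-algebra generated by the countable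
   partition [join_translates alpha act F]. *)
Definition sigma_translates (alpha : set (set T)) (act : Gam -> T -> T)
    (F : set Gam) : set (set T) :=
  <<s \bigcup_(g in F) translate alpha act g >>.

Definition sigma_join (B C : set (set T)) : set (set T) := <<s B `|` C >>.

Definition entropy_rate (alpha A : set (set T)) (act : Gam -> T -> T)
    (F : nat -> {fset Gam}) (i : nat) : \bar R :=
  (cond_entropy (join_translates alpha act (F i)) A * (#|` F i|%:R^-1)%:E)%E.

Definition KS_entropy (alpha A : set (set T)) (act : Gam -> T -> T)
    (F : nat -> {fset Gam}) : \bar R :=
  limn (entropy_rate alpha A act F).

End entropy.

(* Topologies of pointwise convergence, [bool] being discrete. In a past
   function [Phi], [Phi g h] says that [h] belongs to the set [Phi g]. *)
Notation subsets Gam := {ptws Gam -> bool}.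
Notation past_functions Gam := {ptws Gam -> {ptws Gam -> bool}}.

Section random_past.
Context (Gam : groupType).

(* The set [S g], to which [k] belongs iff [k g^-1] belongs to [S]. *)
Definition right_translate (S : subsets Gam) (g : Gam) : subsets Gam :=
  fun k => S (k * g^-1)%g.

Definition invariant_random_past (R : realType)
    (P : probability (borel (past_functions Gam)) R) : Prop :=
  [/\ {ae P, forall Phi : past_functions Gam, forall g, ~~ Phi g g},
      {ae P, forall Phi : past_functions Gam, forall g h, Phi h g ->
         forall k, Phi g k -> Phi h k},
      {ae P, forall Phi : past_functions Gam, forall g h, g != h ->
         Phi h g \/ Phi g h} &
      forall (g : Gam) (S : set (borel (subsets Gam))), measurable S ->
        P [set Phi : past_functions Gam | S (Phi g)] =
        P [set Phi : past_functions Gam | S (right_translate (Phi 1%g) g)]].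

End random_past.

(* Main.v *)
(* Enumerate a finite set F along the random total order "g < h iff g belongs to
   Phi(h)". For a fixed past function, the chain rule writes H(alpha^F | A) as
   the sum over g in F of H(alpha^g | alpha^(F /\ Phi(g)) v A), which by
   invariance of mu is H(alpha | alpha^(F g^-1 /\ Phi(g) g^-1) v A). Taking
   expectations and using that Phi(g) g^-1 is distributed as Phi = Phi(1),
     H(alpha^F | A) = sum over g in F of E H(alpha | alpha^(F g^-1 /\ Phi) v A).
   Every term is at least E H(alpha | alpha^Phi v A). Conversely, for K finite
   the term of g is at most E H(alpha | alpha^(K /\ Phi) v A) when K g is
   contained in F, which by the Folner condition fails for a proportion of F
   that tends to 0; and that bound tends to E H(alpha | alpha^Phi v A) as K
   exhausts the group.

   Monotonicity and continuity of the conditional entropy both come from the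
   tangent inequality - ln x + 1 <= - ln z + z / x. With x = mu(a | B) and
   z any B-measurable function with values in [0, 1], integrating it over a gives
     int_a - ln mu(a | B) + mu(a) <= int_a - ln z + int z,
   with equality for z = x. So no martingale convergence theorem is needed,
   only the L^1-density of the functions measurable with respect to some B_n
   among those measurable with respect to the sigma-algebra they generate. *)
Require Import Defs.
From HB Require Import structures.
From mathcomp Require Import all_boot all_order all_algebra.
From mathcomp Require Import finmap.
From mathcomp Require Import all_classical all_reals all_analysis.
From mathcomp Require Import measurable_realfun ring lra.
Set Implicit Arguments.
Unset Strict Implicit.
Unset Printing Implicit Defensive.
Import Order.TTheory GRing.Theory Num.Theory.
Import numFieldNormedType.Exports.
Local Open Scope classical_set_scope.
Local Open Scope ring_scope.

(** * Conditional probabilities given a sigma-algebra *)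

Local Notation "B -measurable_fun f" :=
  (measurable_fun [set: g_sigma_algebraType B] f) (at level 70).

Lemma ae_mono d (T : measurableType d) (R : realType)
    (mu : {measure set T -> \bar R}) (P Q : T -> Prop) :
  (forall x, P x -> Q x) ->
  {ae mu, forall x, P x} -> {ae mu, forall x, Q x}.
Proof. exact: (@filterS _ _ (ae_filter_ringOfSetsType mu)). Qed.

Lemma measurable_ltr_set d (T : measurableType d) (R : realType) (f g : T -> R) :
  measurable_fun setT f -> measurable_fun setT g ->
  measurable [set x | f x < g x].
Proof.
move=> mf mg; have := measurable_fun_ltr mf mg.
by move=> /(_ measurableT [set true]); rewrite setTI; exact.
Qed.

(** On the set where [g < f] the function [f - g] is nonnegative with integral at most 0, so it
    vanishes there almost everywhere and the set is null. This is how identities tested on the sets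
    of a sigma-algebra become almost sure ones. *)
Lemma ae_le_superlevel d (T : measurableType d) (R : realType)
    (mu : {measure set T -> \bar R}) (f g : T -> R) :
  mu.-integrable setT (EFin \o f) -> mu.-integrable setT (EFin \o g) ->
  (\int[mu]_(x in [set x | (g x < f x)%R]) (f x)%:E <=
   \int[mu]_(x in [set x | (g x < f x)%R]) (g x)%:E)%E ->
  {ae mu, forall x, (f x <= g x)%R}.
Proof.
move=> fi gi; set C := [set x | _] => fgC.
have mf : measurable_fun setT f by apply/measurable_EFinP; exact: measurable_int fi.
have mg : measurable_fun setT g by apply/measurable_EFinP; exact: measurable_int gi.
have mC : measurable C by exact: measurable_ltr_set.
have fiC : mu.-integrable C (EFin \o f) by exact: integrableS fi.
have giC : mu.-integrable C (EFin \o g) by exact: integrableS gi.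
have fg0 : (\int[mu]_(x in C) `|(f x - g x)%:E| = 0)%E.
  apply/eqP; rewrite eq_le integral_ge0// andbT.
  under eq_integral => x /[!inE] Cx.
    rewrite gee0_abs ?lee_fin ?subr_ge0 ?(ltW Cx)// EFinB; over.
  rewrite integralB_EFin// sube_le0//.
have mfg : measurable_fun C (EFin \o (f \- g)).
  by apply/measurable_EFinP/measurable_funB; exact: measurable_funTS.
have [/(_ fg0) [N [mN N0 CN]] _] := ae_eq_integral_abs mu mC mfg.
exists N; split => // x /=.
move/negP; rewrite -ltNge => gf; apply: CN => /= /(_ gf)/eqP.
by rewrite eqe subr_eq0 gt_eqF.
Qed.

Section subalgebra.
Context d (T : measurableType d) (R : realType) (mu : probability T R).
Local Open Scope ereal_scope.

Definition subalgebra (B : set (set T)) :=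
  sigma_algebra [set: T] B /\ B `<=` measurable.

Section fixed_subalgebra.
Variables (B : set (set T)) (sB : subalgebra B).

Lemma subalgebra_measurable C :
  measurable (C : set (g_sigma_algebraType B)) = B C.
Proof. by rewrite /measurable/= (sigma_algebra_id sB.1). Qed.

Lemma measurable_coarsen :
  measurable_fun [set: T] (id : T -> g_sigma_algebraType B).
Proof.
move=> _ Y mY; rewrite setTI; apply: sB.2.
by rewrite -subalgebra_measurable.
Qed.

Lemma subalgebra_measurable_fun d' (Y : measurableType d') (f : T -> Y) :
  B -measurable_fun f -> measurable_fun [set: T] f.
Proof. by move=> mf; exact: (measurableT_comp mf measurable_coarsen). Qed.

(** The restriction of [mu] to [B], obtained as the image of [mu] under the identity map, so that
    Radon-Nikodym and density of simple functions can be applied on the smaller sigma-algebra. *)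
Definition coarsen : probability (g_sigma_algebraType B) R :=
  distribution mu (mfun_Sub (mem_set measurable_coarsen)).

Lemma ge0_integral_coarsen D (f : g_sigma_algebraType B -> \bar R) : B D ->
  measurable_fun setT f -> (forall x, 0 <= f x) ->
  \int[coarsen]_(x in D) f x = \int[mu]_(x in D) f x.
Proof.
move=> BD mf f0; rewrite ge0_integral_pushforward//.
- by rewrite subalgebra_measurable.
- exact: measurable_funTS.
Qed.

Section fixed_set.
Variables (a : set T) (ma : measurable a).

(** The measure C |-> mu(C [&] a) on [B]; its derivative with respect to [coarsen] is the
    conditional probability of [a]. *)
Let trace : set (g_sigma_algebraType B) -> \bar R :=
  pushforward (mrestr mu ma) (mfun_Sub (mem_set measurable_coarsen)).

Let trace0 : trace set0 = 0.
Proof. exact: measure0. Qed.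

Let trace_ge0 C : 0 <= trace C.
Proof. exact: measure_ge0. Qed.

Let trace_sigma_additive : semi_sigma_additive trace.
Proof. exact: measure_semi_sigma_additive. Qed.

HB.instance Definition _ := isMeasure.Build _ _ _ trace
  trace0 trace_ge0 trace_sigma_additive.

Let trace_finite : fin_num_fun trace.
Proof.
move=> C mC; rewrite /trace ge0_fin_numE//.
apply: (@le_lt_trans _ _ 1); last exact: ltry.
apply: probability_le1; apply: measurableI => //; apply: sB.2.
by rewrite -subalgebra_measurable.
Qed.

HB.instance Definition _ := Measure_isFinite.Build _ _ _ trace trace_finite.

Lemma trace_dominates : trace `<< coarsen.
Proof.
apply/null_content_dominatesP => C mC C0.
apply/eqP; rewrite eq_le measure_ge0 andbT.
rewrite -[X in _ <= X]C0; apply: le_measure; rewrite ?inE//.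
- apply: measurableI => //; apply: sB.2; by rewrite -subalgebra_measurable.
- apply: sB.2; by rewrite -subalgebra_measurable.
Qed.

Lemma ge0_integral_trace (f : g_sigma_algebraType B -> \bar R) :
  measurable_fun setT f -> (forall x, 0 <= f x) ->
  \int[trace]_x f x = \int[mu]_(x in a) f x.
Proof.
move=> mf f0; have mfT := subalgebra_measurable_fun mf.
rewrite ge0_integral_pushforward// preimage_setT /comp/=.
rewrite -(setUv a) ge0_integral_setU//; last 3 first.
- exact: measurableC.
- exact: measurable_funTS.
- by apply/disj_setPS; rewrite setICr.
rewrite [X in _ + X](_ : _ = 0) ?adde0; last first.
  rewrite (eq_measure_integral mzero) ?integral_measure_zero// => A mA Aa.
  have Aa0 : A `&` a = set0 by rewrite disjoints_subset.
  by apply/eqP; rewrite /mrestr/= /mrestr Aa0 measure0.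
by apply: eq_measure_integral => A mA Aa; rewrite /mrestr/= /mrestr setIidl.
Qed.

Lemma integrable_unit_interval (f : T -> R) : measurable_fun [set: T] f ->
  (forall x, (0 <= f x <= 1)%R) -> mu.-integrable setT (EFin \o f).
Proof.
move=> mf f01; apply: (@le_integrable _ _ _ _ _ measurableT _ (cst 1)).
- exact/measurable_EFinP.
- move=> x _ /=; rewrite lee_fin normr1 ger0_norm; by case/andP: (f01 x).
- exact: finite_measure_integrable_cst.
Qed.

(** A version of mu(a | B) that is bounded by 0 and 1 everywhere, so that [- lne] of it is
    nonnegative at every point, and whose defining identity is tested on all nonnegative
    [B]-measurable functions, so that quotients such as z / p may be inserted. *)
Definition cond_density (p : T -> R) :=
  [/\ B -measurable_fun p, forall x, (0 <= p x <= 1)%R &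
     forall f : g_sigma_algebraType B -> \bar R, measurable_fun setT f ->
       (forall x, 0 <= f x) ->
       \int[mu]_(x in a) f x = \int[mu]_x (f x * (p x)%:E)].

(** Take the Radon-Nikodym derivative q of [trace]. On C = {q > 1} its integral is mu(C [&] a) <=
    mu(C), so q <= 1 almost everywhere. *)
Lemma cond_density_exists : exists p, cond_density p.
Proof.
pose rn := Radon_Nikodym_SigmaFinite.f trace coarsen.
have rn_ge0 := Radon_Nikodym_SigmaFinite.f_ge0 trace_dominates.
have rn_fin := Radon_Nikodym_SigmaFinite.f_fin_num trace_dominates.
have rn_int := Radon_Nikodym_SigmaFinite.f_integrable trace_dominates.
pose q x := fine (rn x).
have qE x : (q x)%:E = rn x by rewrite fineK.
have q0 x : (0 <= q x)%R by rewrite fine_ge0.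
have mrn : measurable_fun setT rn by exact: measurable_int rn_int.
have mq : B -measurable_fun q by exact: measurableT_comp mrn.
have qP (f : g_sigma_algebraType B -> \bar R) : measurable_fun setT f ->
    (forall x, 0 <= f x) ->
    \int[mu]_(x in a) f x = \int[mu]_x (f x * (q x)%:E).
  move=> mf f0; rewrite -ge0_integral_trace//.
  rewrite -(Radon_Nikodym_SigmaFinite.change_of_variables trace_dominates)//.
  rewrite -[RHS]ge0_integral_coarsen.
  - by apply: eq_integral => x _; rewrite qE.
  - by rewrite -subalgebra_measurable.
  - by apply: emeasurable_funM => //; exact/measurable_EFinP.
  - by move=> x; rewrite mule_ge0 ?lee_fin.
have qi : mu.-integrable setT (EFin \o q).
  apply/integrableP; split.
    by apply/measurable_EFinP; exact: subalgebra_measurable_fun mq.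
  under eq_integral do rewrite gee0_abs ?lee_fin//.
  rewrite (eq_integral (fun x : T => cst 1 x * (q x)%:E)); last first.
    by move=> x _; rewrite mul1e.
  rewrite -(qP (cst 1))// integral_cst// mul1e.
  by rewrite (le_lt_trans (probability_le1 _ ma)) ?ltry.
have q1 : {ae mu, forall x, (q x <= 1)%R}.
  apply: ae_le_superlevel => //; first exact: finite_measure_integrable_cst.
  have BC : B [set x | (1 < q x)%R].
    by rewrite -subalgebra_measurable; apply: measurable_ltr_set.
  have mC := sB.2 _ BC.
  rewrite integral_cst// mul1e.
  rewrite integral_mkcond (eq_integral (fun x : T =>
    (\1_[set x | (1 < q x)%R] x)%:E * (q x)%:E)); last first.
    by move=> x _; rewrite epatch_indic muleC.
  have mind : B -measurable_fun (EFin \o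
      (\1_[set x | (1 < q x)%R] : g_sigma_algebraType B -> R)).
    apply: measurableT_comp => //; apply: measurable_indic.
    by rewrite subalgebra_measurable.
  rewrite -(qP _ mind)//; last by move=> x; rewrite lee_fin.
  rewrite integral_indic//; apply: le_measure; rewrite ?inE//.
  exact: measurableI.
(* Truncation at 1 changes q only on a null set, and gives the bound at every point. *)
exists (fun x => Num.min (q x) 1%R); split.
- by apply: measurable_minr => //; exact: measurable_cst.
- by move=> x; rewrite le_min q0 ler01 ge_min lexx orbT.
- move=> f mf f0; rewrite qP//; apply: ae_eq_integral => //.
  + apply: emeasurable_funM; first exact: subalgebra_measurable_fun mf.
    by apply/measurable_EFinP; exact: subalgebra_measurable_fun mq.
  + apply: emeasurable_funM; first exact: subalgebra_measurable_fun mf.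
    apply/measurable_EFinP; apply: measurable_minr => //.
    exact: subalgebra_measurable_fun mq.
  + move: q1; apply: ae_mono => x qx1 _.
    by rewrite min_l.
Qed.

Lemma cond_density_is_cond_prob p : cond_density p -> is_cond_prob mu B a p.
Proof.
move=> [mp p01 pP]; split => //.
  exact: integrable_unit_interval (subalgebra_measurable_fun mp) p01.
move=> C BC; have mC := sB.2 _ BC.
rewrite integral_mkcond (eq_integral (fun x : T =>
    (\1_C x)%:E * (p x)%:E)); last first.
  by move=> x _; rewrite epatch_indic muleC.
have mind : B -measurable_fun (EFin \o
    (\1_C : g_sigma_algebraType B -> R)).
  apply: measurableT_comp => //; apply: measurable_indic.
  by rewrite subalgebra_measurable.
rewrite -(pP _ mind)//; last by move=> x; rewrite lee_fin.
by rewrite integral_indic// setIC.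
Qed.

(** Since a version exists, the default value 0 in [cond_prob] is never the one selected. *)
Lemma cond_prob_is_cond_prob : is_cond_prob mu B a (cond_prob mu B a).
Proof.
have [p /cond_density_is_cond_prob pP] := cond_density_exists.
exact: (xgetPex (cst 0%R) (ex_intro _ p pP)).
Qed.

(** The set {g < f} belongs to [B], and both versions have the same integral on it. *)
Lemma is_cond_prob_ae_le f g : is_cond_prob mu B a f -> is_cond_prob mu B a g ->
  {ae mu, forall x, (f x <= g x)%R}.
Proof.
move=> [mf intf fP] [mg intg gP]; apply: ae_le_superlevel => //.
have BC : B [set x | (g x < f x)%R].
  by rewrite -subalgebra_measurable; exact: measurable_ltr_set.
by rewrite fP// gP.
Qed.

Lemma is_cond_prob_ae_eq f g : is_cond_prob mu B a f -> is_cond_prob mu B a g ->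
  {ae mu, forall x, f x = g x}.
Proof.
move=> fP gP; have fg := is_cond_prob_ae_le fP gP.
have gf := is_cond_prob_ae_le gP fP.
have := @filterI _ _ (ae_filter_ringOfSetsType mu) _ _ fg gf.
by apply: ae_mono => x [/= fgx gfx]; apply/eqP; rewrite eq_le fgx.
Qed.

Lemma cond_prob_ae_eq p : is_cond_prob mu B a p ->
  {ae mu, forall x, cond_prob mu B a x = p x}.
Proof. by apply: is_cond_prob_ae_eq; exact: cond_prob_is_cond_prob. Qed.

End fixed_set.
End fixed_subalgebra.
End subalgebra.

(** * The information function *)

Lemma measurable_lne d (T : measurableType d) (R : realType) (D : set T)
    (f : T -> R) :
  measurable_fun D f -> measurable_fun D (fun x => lne (f x)%:E).
Proof.
move=> mf; rewrite (_ : (fun _ => _) =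
  (fun r => if (r <= 0)%R then -oo%E else (ln r)%:E) \o f)//.
apply: measurableT_comp => //; apply: measurable_fun_ifT => //=.
- by apply: measurable_fun_ler => //; exact: measurable_cst.
- by apply/measurable_EFinP; exact: measurable_ln.
Qed.

(** This is ln t <= t - 1 at t = y / x; for y = 0 the right-hand side is +oo. *)
Lemma lne_tangent (R : realType) (x y : R) : 0 < x -> 0 <= y ->
  (- lne x%:E + 1 <= - lne y%:E + (y / x)%:E)%E.
Proof.
move=> x0; rewrite le_eqVlt => /predU1P[<-|y0].
  by rewrite [lne 0]/= lexx /= mul0r adde0 leey.
rewrite !lne_EFin// -!EFinN -!EFinD lee_fin -subr_ge0.
have : ln (1 + (y / x - 1)) <= y / x - 1.
  by rewrite le_ln1Dx// ltrBrDl subrr divr_gt0.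
by rewrite addrC subrK ln_div// => h; lra.
Qed.

Section information.
Context d (T : measurableType d) (R : realType) (mu : probability T R).
Local Open Scope ereal_scope.

(** The contribution of the cell [a] to the conditional entropy given [B]. Working cell by cell
    reduces monotonicity and continuity of the entropy to statements about one set. *)
Definition information B a :=
  \int[mu]_(x in a) - lne (cond_prob mu B a x)%:E.

Variables (B : set (set T)) (sB : subalgebra B).
Variables (a : set T) (ma : measurable a).

Lemma information_density p : cond_density mu B a p ->
  information B a = \int[mu]_(x in a) - lne (p x)%:E.
Proof.
move=> pP; have pcp := cond_density_is_cond_prob sB ma pP.
have [mcp _ _] := cond_prob_is_cond_prob mu sB ma; have [mp _ _] := pP.
apply: ae_eq_integral => //.
- apply: measurable_funTS; apply: measurableT_comp => //.
  by apply: measurable_lne; exact: subalgebra_measurable_fun mcp.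
- apply: measurable_funTS; apply: measurableT_comp => //.
  by apply: measurable_lne; exact: subalgebra_measurable_fun mp.
- by move: (cond_prob_ae_eq sB ma pcp); apply: ae_mono => x -> _.
Qed.

Lemma information_ge0 : 0 <= information B a.
Proof.
have [p pP] := cond_density_exists mu sB ma.
rewrite (information_density pP); have [_ p01 _] := pP.
by apply: integral_ge0 => x _; rewrite oppe_ge0 lne_le0 lee_fin; case/andP: (p01 x).
Qed.

(** Testing the identity of p on Z = {p <= 0} gives that mu(a [&] Z) is the integral of p over Z,
    hence 0. *)
Lemma cond_density_gt0 p : cond_density mu B a p ->
  {ae mu, forall x, a x -> (0 < p x)%R}.
Proof.
move=> [mp p01 pP]; have mpT := subalgebra_measurable_fun sB mp.
pose Z := [set x | (p x <= 0)%R].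
have BZ : measurable (Z : set (g_sigma_algebraType B)).
  rewrite (_ : Z = ~` [set x | (0 < p x)%R]); last first.
    by apply/seteqP; split => x /=; rewrite /Z/= leNgt => /negP.
  by apply: measurableC; apply: measurable_ltr_set.
have mZ : measurable Z by apply: sB.2; rewrite -subalgebra_measurable.
exists (a `&` Z); split; first exact: measurableI.
- rewrite setIC -integral_indic//.
  have mind : B -measurable_fun (EFin \o
      (\1_Z : g_sigma_algebraType B -> R)).
    by apply: measurableT_comp => //; apply: measurable_indic.
  rewrite (pP _ mind)//; last by move=> x; rewrite lee_fin.
  apply: integral0_eq => x _; rewrite /= indicE -EFinM; congr EFin.
  have [/set_mem /= Zx|_] := boolP (x \in Z); last by rewrite mul0r.
  by rewrite mul1r; apply/eqP; rewrite eq_le Zx; case/andP: (p01 x).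
- by move=> x /= /not_implyP[ax /negP]; rewrite -leNgt.
Qed.

(** The tangent inequality is integrated over [a], where p > 0 almost everywhere. The function z is
    free: a constant, a version for a smaller algebra and a truncated approximation each give one of
    the later estimates. *)
Lemma information_le (z : T -> R) : B -measurable_fun z ->
  (forall x, (0 <= z x <= 1)%R) ->
  information B a + mu a <=
    \int[mu]_(x in a) - lne (z x)%:E + \int[mu]_x (z x)%:E.
Proof.
move=> mz z01; have [p pP] := cond_density_exists mu sB ma.
rewrite (information_density pP); have p0 := cond_density_gt0 pP.
have [mp p01 ip] := pP; have mpT := subalgebra_measurable_fun sB mp.
have mzT := subalgebra_measurable_fun sB mz.
have mln (f : T -> R) : measurable_fun setT f ->
    measurable_fun a (fun x => - lne (f x)%:E).
  move=> mf; apply: measurable_funTS; apply: measurableT_comp => //.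
  exact: measurable_lne.
have ln0 (f : T -> R) : (forall x, (0 <= f x <= 1)%R) ->
    forall x, a x -> 0 <= - lne (f x)%:E.
  by move=> f01 x _; rewrite oppe_ge0 lne_le0 lee_fin; case/andP: (f01 x).
have zp0 x : 0 <= (z x / p x)%:E.
  by rewrite lee_fin divr_ge0//; [case/andP: (z01 x)|case/andP: (p01 x)].
have mzp : B -measurable_fun (fun x => (z x / p x)%:E).
  (* The inverse of p is written as a power with exponent -1 to obtain its measurability; both agree
     because p >= 0. *)
  rewrite (_ : (fun _ => _) = EFin \o (z \* (@powR R ^~ (-1)%R \o p))%R).
    apply: measurableT_comp => //; apply: measurable_funM => //.
    exact: (measurableT_comp (measurable_powR _) mp).
  apply/funext => x /=; rewrite powR_inv1//; by case/andP: (p01 x).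
have mzpT := subalgebra_measurable_fun sB mzp.
have -> : mu a = \int[mu]_(x in a) (cst 1 x).
  by rewrite integral_cst// mul1e.
rewrite -ge0_integralD//; [|exact: ln0|exact: mln].
apply: (@le_trans _ _ (\int[mu]_(x in a) (- lne (z x)%:E + (z x / p x)%:E))).
  apply: ae_ge0_le_integral => //.
  - by move=> x ax; apply: adde_ge0 => //; exact: ln0.
  - by apply: emeasurable_funD => //; exact: mln.
  - by move=> x ax; apply: adde_ge0 => //; exact: ln0.
  - by apply: emeasurable_funD; [exact: mln|exact: measurable_funTS].
  - have := p0; apply: ae_mono => x px0 ax; apply: lne_tangent; first exact: px0.
    by case/andP: (z01 x).
rewrite ge0_integralD//; [|exact: ln0|exact: mln|exact: measurable_funTS].
(* The identity of p turns the integral of z / p over [a] into that of (z / p) * p, which is at most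
   z: equal to it where p is nonzero, and 0 where p = 0. *)
rewrite leeD2l// ip//; apply: ge0_le_integral => //.
- by move=> x _; rewrite mule_ge0// lee_fin; case/andP: (p01 x).
- by apply: emeasurable_funM => //; exact/measurable_EFinP.
- exact/measurable_EFinP.
- move=> x _; rewrite -EFinM lee_fin.
  have [->|px] := eqVneq (p x) 0%R; first by rewrite mulr0; case/andP: (z01 x).
  by rewrite divfK.
Qed.

(** Choose for z the constant mu(a) in [information_le]; its integral mu(a) cancels. A null set [a]
    is treated apart, both sides being 0. *)
Lemma information_le_shannon :
  information B a <= (- (fine (mu a) * ln (fine (mu a))))%:E.
Proof.
have [a0|a0] := eqVneq (mu a) 0.
  rewrite /information null_set_integral//.
  - by rewrite a0 /= mul0r oppr0.
  - have [mcp _ _] := cond_prob_is_cond_prob mu sB ma.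
    apply: measurable_funTS; apply: measurableT_comp => //.
    by apply: measurable_lne; exact: subalgebra_measurable_fun mcp.
have afin : mu a \is a fin_num by exact: fin_num_measure.
have fa0 : (0 < fine (mu a))%R by rewrite fine_gt0// lt0e a0 measure_ge0 ltey_eq afin.
have fa1 : (fine (mu a) <= 1)%R by rewrite -lee_fin fineK ?probability_le1.
have mz : B -measurable_fun (cst (fine (mu a)) : T -> R).
  exact: measurable_cst.
have z01 (x : T) : (0 <= cst (fine (mu a)) x <= 1)%R by rewrite /= fa1 ltW.
have := information_le mz z01.
rewrite (_ : (\int[mu]_(x in a) _) = - lne (fine (mu a))%:E * mu a); last first.
  by rewrite -integral_cst.
rewrite (_ : (\int[mu]_x _) = mu a); last first.
  rewrite (eq_integral (cst (mu a))); last by move=> x _; rewrite /= fineK.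
  by rewrite integral_cst// [X in _ * X](@probability_setT _ _ _ mu) mule1.
rewrite leeD2rE//.
by rewrite lne_EFin// -EFinN -{2}(fineK afin) -EFinM mulNr mulrC.
Qed.

End information.

(** * Continuity along increasing sequences of sigma-algebras *)

Lemma max_dist (R : realDomainType) (x y x' y' : R) :
  `|Num.max x y - Num.max x' y'| <= `|x - x'| + `|y - y'|.
Proof.
have := (ler_norm (x - x'), ler_norm (x' - x), ler_norm (y - y'),
  ler_norm (y' - y)).
rewrite (distrC x') (distrC y') => -[[[h1 h2] h3] h4].
have h5 := normr_ge0 (x - x'); have h6 := normr_ge0 (y - y').
rewrite ler_norml; apply/andP.
by case: (leP x y) => ?; case: (leP x' y') => ?; split; lra.
Qed.

Lemma clamp_dist (R : realDomainType) (a b x y : R) : a <= b ->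
  `|Num.max a (Num.min x b) - Num.max a (Num.min y b)| <= `|x - y|.
Proof.
move=> ab; have := (ler_norm (x - y), ler_norm (y - x)).
rewrite (distrC y) => -[h1 h2]; have h5 := normr_ge0 (x - y).
rewrite ler_norml; apply/andP.
by case: (leP x b) => ?; case: (leP y b) => ?; case: (leP a x) => ?;
  case: (leP a y) => ?; rewrite ?(max_r ab); split; lra.
Qed.

Section information_limit.
Context d (T : measurableType d) (R : realType) (mu : probability T R).
Local Open Scope ereal_scope.

(** A version p of mu(a | B) is also [C]-measurable, so it may serve as z in [information_le] for
    [C]; its integral is mu(a), which cancels. *)
Lemma information_antitone B C a : subalgebra B -> subalgebra C -> B `<=` C ->
  measurable a -> information mu C a <= information mu B a.
Proof.
move=> sB sC BC ma; have [p pP] := cond_density_exists mu sB ma.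
have [mp p01 _] := pP.
have [_ _ ip] := cond_density_is_cond_prob sB ma pP.
have mpC : C -measurable_fun p.
  move=> _ Y mY; rewrite setTI subalgebra_measurable//; apply: BC.
  by rewrite -subalgebra_measurable// -[X in measurable X]setTI; exact: mp.
have := information_le mu sC ma mpC p01.
rewrite ip ?setIT; last by have [B0 BD _] := sB.1; rewrite -[setT]setD0; exact: BD.
by rewrite leeD2rE ?fin_num_measure// (information_density sB ma pP).
Qed.

Lemma le_integral_dist_triangle (f g h : T -> R) :
  measurable_fun setT f -> measurable_fun setT g -> measurable_fun setT h ->
  \int[mu]_x `|f x - h x|%:E <=
    \int[mu]_x `|f x - g x|%:E + \int[mu]_x `|g x - h x|%:E.
Proof.
move=> mf mg mh.
have md (u v : T -> R) : measurable_fun setT u -> measurable_fun setT v ->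
    measurable_fun setT (fun x => `|u x - v x|%:E).
  move=> mu' mv; apply/measurable_EFinP; apply: measurableT_comp => //.
  exact: measurable_funB.
rewrite -ge0_integralD//; [|exact: md|exact: md].
apply: ge0_le_integral => //; [exact: md|by apply: emeasurable_funD; exact: md|].
move=> x _; rewrite -EFinD lee_fin (le_trans _ (ler_normD _ _))//.
by rewrite addrA subrK.
Qed.

Variables (B : nat -> set (set T)) (sB : forall n, subalgebra (B n)).
Hypothesis ndB : forall n, B n `<=` B n.+1.

(** Membership in the closure, for the L^1 distance, of the functions measurable with respect to
    some [B n]. *)
Definition approximable (f : T -> R) :=
  measurable_fun setT f /\ forall e : R, (0 < e)%R ->
  exists n (z : T -> R), B n -measurable_fun z /\
    \int[mu]_x `|f x - z x|%:E <= e%:E.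

Let ndBm m n : (m <= n)%N -> B m `<=` B n.
Proof.
move=> /subnK <-; elim: (n - m)%N => // k IH; rewrite addSn.
by apply: (subset_trans IH); exact: ndB.
Qed.

Let measB m n (z : T -> R) : (m <= n)%N -> B m -measurable_fun z ->
  B n -measurable_fun z.
Proof.
move=> mn mz _ Y mY; rewrite setTI subalgebra_measurable//; apply: ndBm mn _ _.
by rewrite -subalgebra_measurable// -[X in measurable X]setTI; exact: mz.
Qed.

(** A Lipschitz operation maps approximations to an approximation, once both are viewed at the
    larger of their two indices. It is applied to sums, differences and maxima. Measurability of
    [op] is asked over every measurable type because it is used both on [T] and on the coarser
    sigma-algebras. *)
Lemma approximable_op2 (op : R -> R -> R) (f g : T -> R) :
  (forall d' (U : measurableType d') (u v : U -> R), measurable_fun setT u ->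
    measurable_fun setT v -> measurable_fun setT (fun x => op (u x) (v x))) ->
  (forall x y x' y', `|op x y - op x' y'| <= `|x - x'| + `|y - y'|)%R ->
  approximable f -> approximable g -> approximable (fun x => op (f x) (g x)).
Proof.
move=> mop lop [mf af] [mg ag]; split; first exact: mop.
move=> e e0; have e20 : (0 < e / 2)%R by rewrite divr_gt0.
have [m [z [mz fz]]] := af _ e20; have [n [w [mw gw]]] := ag _ e20.
exists (maxn m n), (fun x => op (z x) (w x)); split.
  apply: (mop _ (g_sigma_algebraType (B (maxn m n)))).
  - by apply: measB mz; rewrite leq_maxl.
  - by apply: measB mw; rewrite leq_maxr.
have mzT := subalgebra_measurable_fun (sB _) mz.
have mwT := subalgebra_measurable_fun (sB _) mw.
rewrite (splitr e) EFinD; apply: le_trans (leeD fz gw).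
have md (u v : T -> R) : measurable_fun setT u -> measurable_fun setT v ->
    measurable_fun setT (fun x => `|u x - v x|%:E).
  move=> mu' mv; apply/measurable_EFinP; apply: measurableT_comp => //.
  exact: measurable_funB.
rewrite -ge0_integralD//; [|exact: md|exact: md].
apply: ge0_le_integral => //.
- by apply: md; exact: mop.
- by apply: emeasurable_funD; exact: md.
- by move=> x _; rewrite -EFinD lee_fin.
Qed.

Lemma approximable_limit (f : T -> R) : measurable_fun setT f ->
  (forall e : R, (0 < e)%R -> exists2 g, approximable g &
    \int[mu]_x `|f x - g x|%:E <= e%:E) -> approximable f.
Proof.
move=> mf af; split=> // e e0; have e20 : (0 < e / 2)%R by rewrite divr_gt0.
have [g [mg ag] fg] := af _ e20; have [n [z [mz gz]]] := ag _ e20.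
exists n, z; split => //; rewrite (splitr e) EFinD.
apply: (le_trans _ (leeD fg gz)); apply: le_integral_dist_triangle => //.
exact: subalgebra_measurable_fun mz.
Qed.

Lemma approximable_measurable n (f : T -> R) : B n -measurable_fun f ->
  approximable f.
Proof.
move=> mf; split; first exact: subalgebra_measurable_fun mf.
move=> e e0; exists n, f; split => //.
by rewrite integral0_eq ?lee_fin ?ltW// => x _; rewrite subrr normr0.
Qed.

Lemma approximableZ (r : R) (f : T -> R) : approximable f ->
  approximable (fun x => r * f x)%R.
Proof.
move=> [mf af]; split; first exact: measurable_funM.
move=> e e0; have r0 : (0 < `|r| + 1)%R by rewrite ltr_wpDl.
have er0 : (0 < e / (`|r| + 1))%R by rewrite divr_gt0.
have [n [z [mz fz]]] := af _ er0; exists n, (fun x => r * z x)%R.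
split; first exact: measurable_funM.
have mzT := subalgebra_measurable_fun (sB _) mz.
under eq_integral do rewrite -mulrBr normrM EFinM.
rewrite ge0_integralZl//; last first.
  apply/measurable_EFinP; apply: measurableT_comp => //.
  exact: measurable_funB.
apply: (@le_trans _ _ (`|r|%:E * (e / (`|r| + 1))%:E)).
  by rewrite lee_wpmul2l// lee_fin.
rewrite -EFinM lee_fin mulrCA ler_piMr ?(ltW e0)//.
by rewrite ler_pdivrMr// mul1r lerDl.
Qed.

Lemma approximable_sum I (r : seq I) (F : I -> T -> R) :
  (forall i, approximable (F i)) ->
  approximable (fun x => \sum_(i <- r) F i x)%R.
Proof.
move=> aF; elim: r => [|i r IH].
  under eq_fun do rewrite big_nil.
  by apply: (@approximable_measurable 0); exact: measurable_cst.
under eq_fun do rewrite big_cons.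
apply: approximable_op2 (aF i) IH.
- by move=> d' U u v; exact: measurable_funD.
- move=> x y x' y'; rewrite (_ : (_ - _ = (x - x') + (y - y'))%R) ?ler_normD//.
  by ring.
Qed.

(** The sets with approximable indicator form a sigma-algebra containing each [B n]: complements
    come from 1 - x, finite unions from the maximum, and countable unions from continuity of [mu]
    along increasing finite unions. *)
Lemma approximable_indic D : <<s \bigcup_n B n >> D ->
  measurable D /\ approximable \1_D.
Proof.
apply: (@smallest_sub _ _ _ (fun D => measurable D /\ approximable \1_D)).
- have acst (r : R) : approximable (cst r).
    by apply: (@approximable_measurable 0); exact: measurable_cst.
  have aU C D' : measurable C -> approximable \1_C ->
      measurable D' -> approximable \1_D' ->
      measurable (C `|` D') /\ approximable \1_(C `|` D').
    move=> mC aC mD aD; split; first exact: measurableU.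
    rewrite (_ : \1_(C `|` D') = fun x => Num.max (\1_C x) (\1_D' x) : R).
      apply: approximable_op2 aC aD.
      + by move=> d' U u v; exact: measurable_maxr.
      + by move=> x y x' y'; exact: max_dist.
    by apply/funext => x; rewrite !indicE in_setU;
      case: (x \in C); case: (x \in D') => /=;
        rewrite ?maxxx ?(max_l (@ler01 R)) ?(max_r (@ler01 R)).
  split.
  + by split => //; rewrite indic0; exact: acst.
  + move=> C [mC aC]; split; first exact: measurableD.
    rewrite (_ : \1_(setT `\` C) = fun x => 1 - \1_C x : R)%R.
      apply: (@approximable_op2 (fun x y => x - y)%R (cst 1%R)) aC => //.
      * by move=> d' U u v; exact: measurable_funB.
      * move=> x y x' y'; rewrite (_ : (_ - _ = (x - x') - (y - y'))%R).
          by rewrite (le_trans (ler_normB _ _)).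
        by ring.
    apply/funext => x; rewrite setTD !indicE in_setC.
    by case: (x \in C) => /=; rewrite ?subrr ?subr0.
  + move=> C /all_and2[mC aC].
    have mUC : measurable (\bigcup_k C k) by exact: bigcup_measurable.
    split => //; apply: approximable_limit; first exact: measurable_indic.
    move=> e e0.
    pose E n := \big[setU/set0]_(i < n.+1) C i.
    have mE n : measurable (E n) /\ approximable \1_(E n).
      elim: n => [|n [mEn aEn]].
        by rewrite /E big_ord_recr big_ord0/= set0U; split.
      by rewrite /E big_ord_recr/=; apply: aU.
    have UEC : (\bigcup_n E n) = \bigcup_n C n by exact: bigcup_bigsetU_bigcup.
    have Dcvg : mu \o E @ \oo --> mu (\bigcup_n C n).
      rewrite -UEC; apply: nondecreasing_cvg_mu => //.
      * by move=> n; case: (mE n).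
      * by rewrite UEC.
      * by move=> m n mn; apply/subsetPset; exact: subset_bigsetU.
    have Ufin : mu (\bigcup_k C k) \is a fin_num by exact: fin_num_measure.
    have [n Dn] : exists n, mu (\bigcup_k C k) - e%:E < mu (E n).
      apply/not_existsP => nD.
      have : limn (mu \o E) <= mu (\bigcup_k C k) - e%:E.
        apply: lime_le; first by apply/cvg_ex; eexists; exact: Dcvg.
        by apply: nearW => n /=; rewrite leNgt; apply/negP; exact: nD.
      rewrite (cvg_lim _ Dcvg)// leeBrDr// -{2}[mu _]adde0 leeD2lE//.
      by rewrite lee_fin leNgt e0.
    exists \1_(E n); first by case: (mE n).
    have DC : E n `<=` \bigcup_k C k by rewrite -UEC; exact: bigcup_sup.
    have mUD : measurable (\bigcup_k C k `\` E n).
      by apply: measurableD => //; case: (mE n).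
    rewrite (eq_integral (fun x => (\1_(\bigcup_k C k `\` E n) x)%:E)).
      rewrite integral_indic// setIT measureD//; last 2 first.
      - by case: (mE n).
      - by rewrite ltey_eq Ufin.
      rewrite setIidr// leeBlDr ?fin_num_measure//; last by case: (mE n).
      by rewrite -leeBlDl// ltW.
    move=> x _; congr EFin; rewrite !indicE in_setD.
    have [xD|xD] := boolP (x \in E n); last by rewrite subr0 andbT normr_nat.
    by rewrite andbF mem_set ?subrr ?normr0//; apply: DC; rewrite inE in xD.
- move=> C [n _ BC]; split; first exact: (sB n).2.
  apply: (@approximable_measurable n); apply: measurable_indic.
  by rewrite subalgebra_measurable.
Qed.

Section limit.
Variables (Binf : set (set T)) (sBinf : subalgebra Binf).
Hypothesis Binf_gen : Binf `<=` <<s \bigcup_n B n >>.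

Import HBSimple.

(** Simple functions are dense in L^1 of the restriction of [mu] to [Binf], and each is a finite
    linear combination of indicators of sets of [Binf]. *)
Lemma approximable_limit_algebra (f : T -> R) : Binf -measurable_fun f ->
  mu.-integrable setT (EFin \o f) -> approximable f.
Proof.
move=> mf fint; have mfT := subalgebra_measurable_fun sBinf mf.
have BT : Binf setT by rewrite -subalgebra_measurable.
have intf : (coarsen mu sBinf).-integrable setT (EFin \o f).
  apply/integrableP; split; first exact/measurable_EFinP.
  rewrite (ge0_integral_coarsen _ _ BT)//.
    by case/integrableP: fint.
  by apply: measurableT_comp => //; exact/measurable_EFinP.
have [g [_ _ gf]] := approximation_sfun_integrable measurableT intf.
apply: approximable_limit => // e e0.
have [n gn] : exists n, \int[coarsen mu sBinf]_z `|(EFin \o f) z - (g n z)%:E|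
    <= e%:E.
  have /fine_cvgP[[n1 _ fin] /cvgrPdist_le/(_ _ e0)[n2 _ dst]] := gf.
  exists (maxn n1 n2); rewrite -[X in X <= _]fineK; last first.
    by apply: fin; rewrite /= leq_maxl.
  rewrite lee_fin; have := dst (maxn n1 n2) (leq_maxr _ _).
  by rewrite sub0r normrN; apply: le_trans; exact: ler_norm.
have mg : Binf -measurable_fun (g n) by exact: measurable_funP.
exists (g n : T -> R).
  rewrite (_ : (g n : T -> R) = fun x =>
      \sum_(i < #|` fset_set (range (g n))|) ((fset_set (range (g n)))`_i *
        \1_(g n @^-1` [set (fset_set (range (g n)))`_i]) x))%R; last first.
    by apply/funext => x; rewrite fimfunEord.
  apply: approximable_sum => i; apply: approximableZ.
  apply: (proj2 (approximable_indic _)); apply: Binf_gen.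
  by rewrite -subalgebra_measurable.
apply: le_trans gn; rewrite (ge0_integral_coarsen _ _ BT)//.
apply: measurableT_comp => //; apply: emeasurable_funB; exact/measurable_EFinP.
Qed.

(** Apply [information_le] for [B n] to an L^1-approximation z of p = mu(a | Binf), truncated to
    [dl, 1]. The truncation keeps the logarithm under control: it is Lipschitz with constant 1 / dl
    on that interval. *)
Lemma information_cvg a : measurable a -> forall e : R, (0 < e)%R ->
  exists n, information mu (B n) a <= information mu Binf a + e%:E.
Proof.
move=> ma e e0; have [p pP] := cond_density_exists mu sBinf ma.
have [mp p01 _] := pP; have mpT := subalgebra_measurable_fun sBinf mp.
have [_ ip ipE] := cond_density_is_cond_prob sBinf ma pP.
rewrite (information_density sBinf ma pP).
(* With L^1 error dl^2, the logarithmic term loses at most dl^2 / dl = dl, and the integral of the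
   truncated z exceeds mu(a) by at most dl + dl^2. The total 2 dl + dl^2 is at most 3 dl <= e. *)
pose dl : R := Num.min (1 / 2)%R (e / 3)%R.
have dl0 : (0 < dl)%R by rewrite lt_min; apply/andP; split; lra.
have dl1 : (dl < 1)%R by rewrite gt_min; apply/orP; left; lra.
have dle : (dl <= e / 3)%R by rewrite ge_min lexx orbT.
have [_ /(_ (dl ^+ 2)%R)[|n [z [mz pz]]]] := approximable_limit_algebra mp ip.
  by rewrite exprn_gt0.
exists n.
pose clamp (r : R) := Num.max dl (Num.min r 1%R).
have clamp01 r : (dl <= clamp r <= 1)%R.
  by rewrite le_max lexx/= ge_max (ltW dl1)/= ge_min lexx orbT.
have clampL r s : (`|clamp r - clamp s| <= `|r - s|)%R.
  by apply: clamp_dist; exact: ltW.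
have mz' : B n -measurable_fun (clamp \o z).
  by apply: measurable_maxr; [exact: measurable_cst|exact: measurable_minr].
have mzT := subalgebra_measurable_fun (sB n) mz.
have mczT := subalgebra_measurable_fun (sB n) mz'.
have cz01 x : (0 <= (clamp \o z) x <= 1)%R.
  by have /andP[cz0 cz1] := clamp01 (z x); rewrite /= cz1 (le_trans (ltW dl0)).
have := information_le mu (sB n) ma mz' cz01.
have afin : mu a \is a fin_num by exact: fin_num_measure.
rewrite -leeBrDr// => /le_trans; apply.
pose q x := `|p x - z x|%R.
have mq : measurable_fun setT q.
  by apply: measurableT_comp => //; exact: measurable_funB.
have mlnp : measurable_fun a (fun x => - lne (p x)%:E).
  apply: measurable_funTS; apply: measurableT_comp => //.
  exact: measurable_lne.
have lnp0 x : 0 <= - lne (p x)%:E.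
  by rewrite oppe_ge0 lne_le0 lee_fin; case/andP: (p01 x).
have h1 : \int[mu]_(x in a) - lne ((clamp \o z) x)%:E <=
    \int[mu]_(x in a) - lne (p x)%:E + dl%:E.
  apply: (@le_trans _ _ (\int[mu]_(x in a) (- lne (p x)%:E + (dl^-1 * q x)%:E))).
    apply: ge0_le_integral => //.
    - move=> x _; rewrite oppe_ge0 lne_le0 lee_fin; by case/andP: (cz01 x).
    - apply: measurable_funTS; apply: measurableT_comp => //.
      exact: measurable_lne.
    - apply: emeasurable_funD => //; apply: measurable_funTS.
      by apply/measurable_EFinP; exact: measurable_funM.
    - move=> x _; have /andP[cz0 cz1] := clamp01 (z x).
      have [p0|p0] := leP (p x) 0%R.
        by rewrite [lne (p x)%:E]le0_lneNy ?lee_fin// addye ?leey// ltNye.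
      rewrite !lne_EFin//=; last exact: lt_le_trans cz0.
      rewrite -?EFinN -?EFinD lee_fin.
      have czpos : (0 < clamp (z x))%R by exact: lt_le_trans cz0.
      have y0 : (0 < clamp (p x))%R.
        by rewrite (lt_le_trans dl0)//; case/andP: (clamp01 (p x)).
      have py : (p x <= clamp (p x))%R.
        rewrite /clamp min_l; last by case/andP: (p01 x).
        by rewrite le_max lexx orbT.
      (* The three bounds chain as ln p - ln (clamp z) <= ln (clamp p) - ln (clamp z) <= (clamp p -
         clamp z) / clamp z <= |p - z| / dl, the last one because clamp z >= dl. *)
      have l1 : (ln (p x) <= ln (clamp (p x)))%R by rewrite ler_ln.
      have l2 : (ln (clamp (p x)) - ln (clamp (z x)) <=
          clamp (p x) / clamp (z x) - 1)%R.
        rewrite -ln_div//.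
        have := @le_ln1Dx R (clamp (p x) / clamp (z x) - 1)%R.
        by rewrite (addrC 1%R) subrK; apply; rewrite ltrBrDl subrr divr_gt0.
      have l3 : (clamp (p x) / clamp (z x) - 1 <= dl^-1 * q x)%R.
        rewrite -[X in (_ - X <= _)%R](@divff _ (clamp (z x))) ?gt_eqF// -mulrBl.
        rewrite ler_pdivrMr//.
        apply: (@le_trans _ _ (q x)).
          by rewrite (le_trans (ler_norm _))// clampL.
        rewrite mulrAC ler_peMl//; first exact: normr_ge0.
        by rewrite mulrC ler_pdivlMr// mul1r.
      lra.
  rewrite ge0_integralD//; last 2 first.
  - by move=> x _; rewrite lee_fin mulr_ge0 ?invr_ge0 ?(ltW dl0)//; exact: normr_ge0.
  - by apply: measurable_funTS; apply/measurable_EFinP; exact: measurable_funM.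
  rewrite leeD2l//.
  apply: (@le_trans _ _ (\int[mu]_x (dl^-1 * q x)%:E)).
    apply: ge0_subset_integral => //.
    - by apply/measurable_EFinP; exact: measurable_funM.
    - by move=> x _; rewrite lee_fin mulr_ge0 ?invr_ge0 ?(ltW dl0)//; exact: normr_ge0.
  under eq_integral do rewrite EFinM.
  rewrite ge0_integralZl//; last 3 first.
  - exact/measurable_EFinP.
  - by move=> x _; rewrite lee_fin; exact: normr_ge0.
  - by rewrite lee_fin invr_ge0 ltW.
  apply: (@le_trans _ _ (dl^-1%:E * (dl ^+ 2)%:E)).
    by rewrite lee_wpmul2l// lee_fin invr_ge0 ltW.
  by rewrite -EFinM lee_fin expr2 mulrA mulVf ?mul1r// gt_eqF.
have h2 : \int[mu]_x ((clamp \o z) x)%:E <= mu a + (dl + dl ^+ 2)%:E.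
  apply: (@le_trans _ _ (\int[mu]_x ((p x)%:E + (dl%:E + (q x)%:E)))).
    apply: ge0_le_integral => //.
    - by move=> x _; rewrite lee_fin; case/andP: (cz01 x).
    - exact/measurable_EFinP.
    - apply: emeasurable_funD; first exact/measurable_EFinP.
      by apply: emeasurable_funD => //; exact/measurable_EFinP.
    - move=> x _; rewrite -!EFinD lee_fin /=.
      have l1 : (clamp (z x) <= clamp (p x) + q x)%R.
        rewrite -lerBlDl (le_trans (ler_norm _))// /q distrC; exact: clampL.
      have l2 : (clamp (p x) <= p x + dl)%R.
        rewrite /clamp min_l; last by case/andP: (p01 x).
        by rewrite ge_max lerDr lerDl (ltW dl0) andbT; case/andP: (p01 x).
      lra.
  rewrite ge0_integralD//; last 4 first.
  - by move=> x _; rewrite lee_fin; case/andP: (p01 x).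
  - exact/measurable_EFinP.
  - by move=> x _; rewrite -EFinD lee_fin addr_ge0 ?(ltW dl0)//; exact: normr_ge0.
  - by apply: emeasurable_funD => //; exact/measurable_EFinP.
  rewrite ge0_integralD//; last 3 first.
  - by move=> x _; rewrite lee_fin ltW.
  - by move=> x _; rewrite lee_fin; exact: normr_ge0.
  - exact/measurable_EFinP.
  rewrite ipE ?setIT; last by rewrite -subalgebra_measurable.
  rewrite leeD2l// EFinD leeD// (_ : \int[mu]_x dl%:E = dl%:E)//.
  rewrite (integral_cst mu measurableT dl%:E).
  by rewrite [X in _ * X](@probability_setT _ _ _ mu) mule1.
apply: (le_trans (leeB (leeD h1 h2) (lexx (mu a)))).
rewrite [mu a + _]addeC addeA addeK// -addeA leeD2l//.
rewrite -EFinD lee_fin.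
have : (dl ^+ 2 <= dl)%R by rewrite expr2 ler_piMr ?ltW.
lra.
Qed.

End limit.
End information_limit.

(** * Conditional entropy of a countable partition *)

Section entropy_series.
Context d (T : measurableType d) (R : realType) (mu : probability T R).
Local Open Scope ereal_scope.

(** The sets [e i] may be empty, which covers finite partitions, and [alpha] is constrained only
    through [cell], the only way it enters [cond_entropy]. *)
Definition cells_enum (alpha : set (set T)) (e : nat -> set T) :=
  [/\ forall i, measurable (e i), trivIset setT e, \bigcup_i e i = setT &
      forall i x, e i x -> cell alpha x = e i].

Lemma measurable_cell alpha e x : cells_enum alpha e ->
  measurable (cell alpha x).
Proof.
move=> [me _ Ue ce]; have [i _ ix] : (\bigcup_i e i) x by rewrite Ue.
by rewrite (ce _ _ ix).
Qed.

Lemma measurable_fun_cell alpha e d' (Y : measurableType d')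
    (f : set T -> T -> Y) : cells_enum alpha e ->
  (forall i, measurable_fun setT (f (e i))) ->
  measurable_fun setT (fun x => f (cell alpha x) x).
Proof.
move=> [me _ Ue ce] mf; rewrite -Ue; apply/measurable_fun_bigcup => // i.
apply: (eq_measurable_fun (f (e i))).
  by move=> x /set_mem ix; rewrite (ce _ _ ix).
exact: measurable_funTS.
Qed.

(* Unlike [cond_prob], everywhere with values in [0, 1] (on measurable sets). *)
Definition density B a : T -> R := xget (cst 0%R) (cond_density mu B a).

Section fixed_subalgebra.
Variables (B : set (set T)) (sB : subalgebra B).

Lemma densityP a : measurable a -> cond_density mu B a (density B a).
Proof.
move=> ma; have [p pP] := cond_density_exists mu sB ma.
exact: (xgetPex (cst 0%R) (ex_intro _ p pP)).
Qed.

Lemma measurable_density a : measurable a -> B -measurable_fun density B a.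
Proof. by move=> /densityP[]. Qed.

Lemma measurable_density' a : measurable a -> measurable_fun setT (density B a).
Proof.
by move=> /measurable_density; exact: (subalgebra_measurable_fun sB).
Qed.

Lemma density_ge0 a x : measurable a -> (0 <= density B a x)%R.
Proof. by move=> /densityP[_ /(_ x)/andP[]]. Qed.

Lemma density_le1 a x : measurable a -> (density B a x <= 1)%R.
Proof. by move=> /densityP[_ /(_ x)/andP[]]. Qed.

Lemma lne_density_ge0 a x : measurable a -> 0 <= - lne (density B a x)%:E.
Proof. by move=> ma; rewrite oppe_ge0 lne_le0 lee_fin density_le1. Qed.

Section fixed_partition.
Variables (alpha : set (set T)) (e : nat -> set T).
Hypothesis alphae : cells_enum alpha e.

Lemma measurable_lne_density_cell :
  measurable_fun setT (fun x => - lne (density B (cell alpha x) x)%:E).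
Proof.
apply: (@measurable_fun_cell alpha e _ _ (fun a x => - lne (density B a x)%:E)) => //.
move=> i; apply: measurableT_comp => //; apply: measurable_lne.
by apply: measurable_density'; have [] := alphae.
Qed.

Lemma lne_density_cell_ge0 x : 0 <= - lne (density B (cell alpha x) x)%:E.
Proof. by apply: lne_density_ge0; exact: measurable_cell alphae. Qed.

(** There are countably many cells, so outside a single null set the chosen versions agree with the
    bounded ones on all cells at once. *)
Lemma cond_entropy_density : cond_entropy mu alpha B =
  \int[mu]_x - lne (density B (cell alpha x) x)%:E.
Proof.
have [me _ Ue ce] := alphae.
rewrite /cond_entropy; apply/eqP; rewrite eqe_oppLR; apply/eqP.
rewrite -integral_ge0N; last by move=> x _; exact: lne_density_cell_ge0.
apply: ae_eq_integral => //.
- apply: (@measurable_fun_cell alpha e _ _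
      (fun a x => lne (cond_prob mu B a x)%:E)) => //.
  move=> i; apply: measurable_lne.
  have [mcp _ _] := cond_prob_is_cond_prob mu sB (me i).
  exact: (subalgebra_measurable_fun sB mcp).
- by apply: measurableT_comp => //; exact: measurable_lne_density_cell.
- have : {ae mu, forall x, forall i, cond_prob mu B (e i) x = density B (e i) x}.
    apply: ae_foralln => i; apply: (cond_prob_ae_eq sB (me i)).
    exact: (cond_density_is_cond_prob sB (me i) (densityP (me i))).
  apply: ae_mono => x px _; rewrite oppeK.
  have [i _ ix] : (\bigcup_i e i) x by rewrite Ue.
  by rewrite (ce _ _ ix) px.
Qed.

Lemma cond_entropy_information : cond_entropy mu alpha B =
  \sum_(i <oo) information mu B (e i).
Proof.
have [me te Ue ce] := alphae.
rewrite cond_entropy_density.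
have mG := measurable_lne_density_cell; have G0 := lne_density_cell_ge0.
set G := fun x => - lne _ in mG *.
transitivity (\int[mu]_(x in \bigcup_i e i) G x); first by rewrite Ue.
rewrite (@ge0_integral_bigcup _ _ _ mu e G me _ _ te); last 2 first.
- by rewrite Ue.
- by move=> x _; exact: G0.
apply: eq_eseriesr => i _.
rewrite (information_density sB (me i) (densityP (me i))).
by apply: eq_integral => x /set_mem ix; rewrite /G (ce _ _ ix).
Qed.

Lemma cond_entropy_ge0 : 0 <= cond_entropy mu alpha B.
Proof.
rewrite cond_entropy_density; apply: integral_ge0 => x _.
exact: lne_density_cell_ge0.
Qed.

Definition shannon_term (a : set T) : \bar R :=
  (- (fine (mu a) * ln (fine (mu a))))%:E.

Lemma cond_entropy_le_shannon :
  cond_entropy mu alpha B <= \sum_(i <oo) shannon_term (e i).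
Proof.
have [me _ _ _] := alphae.
rewrite cond_entropy_information; apply: lee_nneseries.
- by move=> i _ _; exact: information_ge0.
- by move=> i _; exact: information_le_shannon.
Qed.

End fixed_partition.
End fixed_subalgebra.

Lemma cond_entropy_antitone alpha e B C : cells_enum alpha e ->
  subalgebra B -> subalgebra C -> B `<=` C ->
  cond_entropy mu alpha C <= cond_entropy mu alpha B.
Proof.
move=> ae sB sC BC.
rewrite (cond_entropy_information sB ae) (cond_entropy_information sC ae).
have [me _ _ _] := ae.
apply: lee_nneseries.
- by move=> i _ _; exact: information_ge0.
- by move=> i _; exact: information_antitone.
Qed.

(** Dominated convergence for the counting measure on the cells: each information term converges by
    [information_cvg] and monotonicity, and is dominated by the summable Shannon term of its
    cell. *)
Lemma cond_entropy_cvg alpha e (B : nat -> set (set T)) (Binf : set (set T)) :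
  cells_enum alpha e -> \sum_(i <oo) shannon_term (e i) < +oo ->
  (forall n, subalgebra (B n)) -> (forall n, B n `<=` B n.+1) ->
  subalgebra Binf -> (forall n, B n `<=` Binf) ->
  Binf `<=` <<s \bigcup_n B n >> ->
  cond_entropy mu alpha (B n) @[n --> \oo] --> cond_entropy mu alpha Binf.
Proof.
move=> ae sfin sB ndB sBinf BBinf Binf_gen; have [me _ _ _] := ae.
pose f n i := information mu (B n) (e i).
pose f' i := information mu Binf (e i).
have f0 n i : 0 <= f n i by exact: information_ge0.
have f'0 i : 0 <= f' i by exact: information_ge0.
have fs n i : f n i <= shannon_term (e i) by exact: information_le_shannon.
have f's i : f' i <= shannon_term (e i) by exact: information_le_shannon.
have s0 i : 0 <= shannon_term (e i) by exact: le_trans (f's i).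
have mnat (h : nat -> \bar R) : measurable_fun setT h by [].
have [] := @dominated_convergence _ _ _ counting setT measurableT f f'
    (shannon_term \o e) (fun n => mnat _) (mnat _).
- apply: aeW => i _.
  have ffin n : f n i \is a fin_num.
    by rewrite ge0_fin_numE// (le_lt_trans (fs n i))// ltry.
  have f'fin : f' i \is a fin_num.
    by rewrite ge0_fin_numE// (le_lt_trans (f's i))// ltry.
  rewrite -(fineK f'fin); apply/fine_cvgP; split; first by apply: nearW => n; exact: ffin.
  apply/cvgrPdist_le => eps eps0.
  have [N fN] := information_cvg mu sB ndB sBinf Binf_gen (me i) eps0.
  exists N => // n /= Nn.
  have f'f : f' i <= f n i by exact: information_antitone.
  have ffN : f n i <= f N i.
    apply: information_antitone => //.
    elim: n Nn {f'f} => [|n IH]; first by rewrite leqn0 => /eqP ->.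
    rewrite leq_eqVlt => /predU1P[->//|/IH /subset_trans]; apply.
    exact: ndB.
  rewrite distrC ger0_norm; last by rewrite subr_ge0 fine_le.
  rewrite lerBlDl -lee_fin EFinD !fineK//.
  exact: le_trans ffN fN.
- apply/integrableP; split; first exact: mnat.
  rewrite (eq_integral (fun i => shannon_term (e i))).
    by rewrite (@ge0_integral_count R (fun i => shannon_term (e i))).
  by move=> i _; exact: gee0_abs (s0 i).
- by apply: aeW => i n _; rewrite (gee0_abs (f0 n i)); exact: fs.
move=> _ _; rewrite ge0_integral_count// (cond_entropy_information sBinf ae).
rewrite (_ : (fun n => \int[counting]_i f n i) =
  fun n => cond_entropy mu alpha (B n))//.
by apply/funext => n; rewrite ge0_integral_count// (cond_entropy_information (sB n) ae).
Qed.

End entropy_series.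

(** * Chain rule and invariance *)

(** Both factors being at most 1, both terms on the right are nonnegative, so a zero factor makes
    each side +oo and no indeterminate sum occurs. *)
Lemma oppe_lneM (R : realType) (x y : R) : 0 <= x <= 1 -> 0 <= y <= 1 ->
  (- lne (x * y)%:E = - lne x%:E + - lne y%:E)%E.
Proof.
move=> /andP[x0 x1] /andP[y0 y1].
have neNy (z : R) : z <= 1 -> (- lne z%:E != -oo)%E.
  by move=> z1; rewrite gt_eqF// (lt_le_trans (ltNy0))// oppe_ge0 lne_le0 lee_fin.
have [->|x_neq0] := eqVneq x 0.
  by rewrite mul0r [lne 0]le0_lneNy//= addye// neNy.
have [->|y_neq0] := eqVneq y 0.
  by rewrite mulr0 [lne 0]le0_lneNy//= addey// neNy.
have xp : 0 < x by rewrite lt0r x_neq0. have yp : 0 < y by rewrite lt0r y_neq0.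
by rewrite !lne_EFin ?mulr_gt0// lnM ?posrE// -?EFinN -EFinD opprD.
Qed.

Section entropy_rules.
Context d (T : measurableType d) (R : realType) (mu : probability T R).
Local Open Scope ereal_scope.

Lemma integral_indicM (D : set T) (f : T -> \bar R) :
  \int[mu]_(x in D) f x = \int[mu]_x (f x * (\1_D x)%:E).
Proof. by rewrite integral_mkcond epatch_indic. Qed.

Lemma subalgebra_measurable_funW B C d' (Y : measurableType d') (f : T -> Y) :
  subalgebra B -> subalgebra C -> B `<=` C ->
  B -measurable_fun f -> C -measurable_fun f.
Proof.
move=> sB sC BC mf _ Y' mY; rewrite setTI subalgebra_measurable//; apply: BC.
by rewrite -subalgebra_measurable// -[X in measurable X]setTI; exact: mf.
Qed.

Lemma measurable_fun_indic (B : set (set T)) D : subalgebra B -> B D ->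
  B -measurable_fun (\1_D : T -> R).
Proof.
move=> sB BD; apply: measurable_indic.
by rewrite subalgebra_measurable.
Qed.

Section chain.
Variables (B C : set (set T)) (sB : subalgebra B) (sC : subalgebra C).
Hypothesis BC : B `<=` C.

(* Both sides are [C]-measurable, so it is enough to integrate them on the sets
   of [C]; there the defining properties of the three densities turn both
   integrals into that of [density B b * density B (a `&` b)]. *)
Lemma density_chain a b : measurable a -> C b ->
  (forall D, C D -> exists2 D', B D' & D `&` b = D' `&` b) ->
  {ae mu, forall x, b x ->
    density mu B (a `&` b) x = (density mu B b x * density mu C a x)%R}.
Proof.
move=> ma Cb trace; have mb := sC.2 _ Cb.
have mab : measurable (a `&` b) by exact: measurableI.
have [mq q01 iq] := densityP mu sB mab; have [mr r01 ir] := densityP mu sB mb.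
have [ms s01 is_] := densityP mu sC ma.
set q := density mu B (a `&` b) in mq q01 iq *.
set r := density mu B b in mr r01 ir *.
set s := density mu C a in ms s01 is_ *.
have q0 x : (0 <= q x)%R by case/andP: (q01 x).
have r0 x : (0 <= r x)%R by case/andP: (r01 x).
have s0 x : (0 <= s x)%R by case/andP: (s01 x).
pose f x := (q x * \1_b x)%R; pose g x := (r x * s x * \1_b x)%R.
have mqC := subalgebra_measurable_funW sB sC BC mq.
have mrC := subalgebra_measurable_funW sB sC BC mr.
have mb1 := measurable_fun_indic sC Cb.
have mf : C -measurable_fun f by exact: measurable_funM.
have mg : C -measurable_fun g.
  by apply: measurable_funM => //; exact: measurable_funM.
have ind01 D (x : T) : (0 <= (\1_D x : R) <= 1)%R.
  by rewrite indicE; case: (x \in D); rewrite /= ?lexx ?ler01.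
have M01 (u v : R) : (0 <= u <= 1 -> 0 <= v <= 1 -> 0 <= u * v <= 1)%R.
  by move=> /andP[u0 u1] /andP[v0 v1]; rewrite mulr_ge0//= mulr_ile1.
have fi : mu.-integrable setT (EFin \o f).
  apply: integrable_unit_interval; first exact: (subalgebra_measurable_fun sC mf).
  by move=> x; exact: M01.
have gi : mu.-integrable setT (EFin \o g).
  apply: integrable_unit_interval; first exact: (subalgebra_measurable_fun sC mg).
  by move=> x; apply: (M01) => //; exact: (M01).
have fg D : C D -> \int[mu]_(x in D) (f x)%:E = \int[mu]_(x in D) (g x)%:E.
  (* Inside b the set D of [C] coincides with a set D' of [B], which makes the test functions
     [B]-measurable. *)
  move=> CD; have [D' BD' DD'] := trace _ CD.
  have mD1 := measurable_fun_indic sC CD.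
  have mD'1 := measurable_fun_indic sB BD'.
  have DD1 x : (\1_D x * \1_b x = \1_D' x * \1_b x :> R)%R.
    have := congr1 (fun E => \1_E x : R) DD'.
    by rewrite !indicI.
  transitivity (\int[mu]_x (\1_D' x * q x * r x)%:E).
    under [RHS]eq_integral do rewrite EFinM.
    rewrite -ir; last 2 first.
    - apply/measurable_EFinP; exact: measurable_funM.
    - by move=> x; rewrite lee_fin mulr_ge0.
    rewrite (integral_indicM D) (integral_indicM b).
    apply: eq_integral => x _; rewrite -!EFinM.
    congr EFin; transitivity (q x * (\1_D x * \1_b x))%R; rewrite /f; first ring.
    by rewrite DD1; ring.
  transitivity (\int[mu]_x (\1_D' x * r x * q x)%:E).
    by apply: eq_integral => x _; congr EFin; ring.
  under eq_integral do rewrite EFinM.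
  rewrite -iq; last 2 first.
  - apply/measurable_EFinP; exact: measurable_funM.
  - by move=> x; rewrite lee_fin mulr_ge0.
  transitivity (\int[mu]_x (\1_D x * \1_b x * r x * s x)%:E).
    under [RHS]eq_integral do rewrite EFinM.
    rewrite -is_; last 2 first.
    - apply/measurable_EFinP; apply: measurable_funM => //.
      exact: measurable_funM.
    - by move=> x; rewrite lee_fin !mulr_ge0.
    rewrite (integral_indicM a) (integral_indicM (a `&` b)).
    apply: eq_integral => x _; rewrite -!EFinM.
    by congr EFin; rewrite DD1 indicI /=; ring.
  rewrite (integral_indicM D); apply: eq_integral => x _; rewrite -!EFinM.
  by congr EFin; rewrite /g; ring.
have Clt (u v : T -> R) : C -measurable_fun u -> C -measurable_fun v ->
    C [set x | (u x < v x)%R].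
  move=> mu' mv; rewrite -subalgebra_measurable//; exact: measurable_ltr_set.
have fg_le : {ae mu, forall x, (f x <= g x)%R}.
  by apply: ae_le_superlevel => //; rewrite fg//; exact: Clt.
have gf_le : {ae mu, forall x, (g x <= f x)%R}.
  by apply: ae_le_superlevel => //; rewrite fg//; exact: Clt.
have := @filterI _ _ (ae_filter_ringOfSetsType mu) _ _ fg_le gf_le.
apply: ae_mono => x [/= fgx gfx] bx.
have /eqP : f x == g x by rewrite eq_le fgx.
by rewrite /f /g indicE mem_set// !mulr1.
Qed.

(* Partitions enter only through the function [cell]: [gamma] stands for the
   join of [alpha] and [beta]. *)
Lemma cond_entropy_chain alpha beta gamma ea eb eg :
  cells_enum alpha ea -> cells_enum beta eb -> cells_enum gamma eg ->
  (forall x, cell gamma x = cell alpha x `&` cell beta x) ->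
  (forall j, C (eb j)) ->
  (forall j D, C D -> exists2 D', B D' & D `&` eb j = D' `&` eb j) ->
  cond_entropy mu gamma B = cond_entropy mu beta B + cond_entropy mu alpha C.
Proof.
move=> ae be ge_ cellg Ceb trace.
have [ma _ Ua ca] := ae; have [mb _ Ub cb] := be; have [mg _ _ _] := ge_.
have a0 := lne_density_cell_ge0 mu sC ae.
have b0 := lne_density_cell_ge0 mu sB be.
have g0 := lne_density_cell_ge0 mu sB ge_.
have mla := measurable_lne_density_cell mu sC ae.
have mlb := measurable_lne_density_cell mu sB be.
have mlg := measurable_lne_density_cell mu sB ge_.
rewrite (cond_entropy_density mu sB ge_) (cond_entropy_density mu sB be).
rewrite (cond_entropy_density mu sC ae) -ge0_integralD//.
apply: ge0_ae_eq_integral => //.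
- exact: emeasurable_funD.
- by move=> x _; rewrite adde_ge0.
(* The pairs of cells are countably many, so the product formula holds for all of them outside one
   null set; its negative logarithm is the required identity of integrands. *)
have : {ae mu, forall x, forall i j, eb j x -> density mu B (ea i `&` eb j) x =
    (density mu B (eb j) x * density mu C (ea i) x)%R}.
  apply: ae_foralln => i; apply: ae_foralln => j.
  by apply: density_chain => // D; exact: trace.
apply: ae_mono => x xij _; rewrite cellg.
have [i _ ix] : (\bigcup_i ea i) x by rewrite Ua.
have [j _ jx] : (\bigcup_i eb i) x by rewrite Ub.
rewrite (ca _ _ ix) (cb _ _ jx) xij//; apply: oppe_lneM.
- by rewrite density_ge0//= density_le1.
- by rewrite density_ge0//= density_le1.
Qed.

End chain.

Section transport.
Variables (tau : T -> T) (mtau : measurable_fun setT tau).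
Hypothesis tau_pmp : forall D, measurable D -> mu (tau @^-1` D) = mu D.
Variables (B B' : set (set T)) (sB : subalgebra B) (sB' : subalgebra B').
Hypothesis preB : forall D, B D -> B' (tau @^-1` D).
Hypothesis preB' : forall D', B' D' -> exists2 D, B D & D' = tau @^-1` D.

Lemma ge0_integral_pmp D (f : T -> \bar R) : measurable D ->
  measurable_fun setT f -> (forall x, 0 <= f x) ->
  \int[mu]_(x in tau @^-1` D) f (tau x) = \int[mu]_(x in D) f x.
Proof.
move=> mD mf f0.
rewrite -[LHS](ge0_integral_pushforward mtau mu mD (measurable_funTS mf))//.
apply: eq_measure_integral => E mE _.
exact: tau_pmp.
Qed.

(** The function mu(a | B) composed with [tau] is [B']-measurable, and every set of [B'] is some
    tau^-1 D; invariance of [mu] gives it the integral mu(D [&] a) = mu(tau^-1 D [&] tau^-1 a)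
    there. Almost sure uniqueness concludes. *)
Lemma density_pmp a : measurable a ->
  {ae mu, forall x, density mu B' (tau @^-1` a) x = density mu B a (tau x)}.
Proof.
move=> ma.
have mta : measurable (tau @^-1` a) by rewrite -[X in measurable X]setTI; exact: mtau.
have dB' := cond_density_is_cond_prob sB' mta (densityP mu sB' mta).
have dB := cond_density_is_cond_prob sB ma (densityP mu sB ma).
apply: (is_cond_prob_ae_eq sB' dB'); have [mp _ ip] := dB; split.
- move=> _ Y mY; rewrite setTI subalgebra_measurable//.
  rewrite (_ : _ @^-1` Y = tau @^-1` (density mu B a @^-1` Y))//.
  apply: preB; rewrite -subalgebra_measurable// -[X in measurable X]setTI.
  exact: mp.
- apply: integrable_unit_interval.
    apply: measurableT_comp => //; exact: measurable_density'.
  by move=> x; rewrite density_ge0// density_le1.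
- move=> _ /preB'[D BD ->]; have mD := sB.2 _ BD.
  rewrite (@ge0_integral_pmp D (fun x => (density mu B a x)%:E))//.
  + by rewrite ip// -preimage_setI tau_pmp//; exact: measurableI.
  + by apply/measurable_EFinP; exact: measurable_density'.
  + by move=> x; rewrite lee_fin density_ge0.
Qed.

Lemma cond_entropy_pmp alpha alpha' e :
  cells_enum alpha e -> cells_enum alpha' (fun i => tau @^-1` e i) ->
  cond_entropy mu alpha' B' = cond_entropy mu alpha B.
Proof.
move=> ae ae'; have [me _ Ue ce] := ae; have [_ _ _ ce'] := ae'.
rewrite (cond_entropy_density mu sB ae) (cond_entropy_density mu sB' ae').
have mh := measurable_lne_density_cell mu sB ae.
have h0 := lne_density_cell_ge0 mu sB ae.
rewrite -[RHS](ge0_integral_pmp measurableT mh h0) preimage_setT.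
apply: ge0_ae_eq_integral => //.
- exact: (measurable_lne_density_cell mu sB' ae').
- exact: measurableT_comp mh mtau.
- by move=> x _; exact: (lne_density_cell_ge0 mu sB' ae' x).
have : {ae mu, forall x, forall i, density mu B' (tau @^-1` e i) x =
    density mu B (e i) (tau x)}.
  by apply: ae_foralln => i; exact: density_pmp.
apply: ae_mono => x xi _.
have [i _ ix] : (\bigcup_i e i) (tau x) by rewrite Ue.
by rewrite (ce _ _ ix) (ce' i x)// xi.
Qed.

End transport.
End entropy_rules.

(** * Enumerations of the cells of a partition *)

Section enumeration.
Context d (T : measurableType d) (R : realType) (mu : probability T R).
Local Open Scope ereal_scope.

Lemma cell_partition (alpha : set (set T)) x A :
  countable_partition alpha -> alpha A -> A x ->
  cell alpha x = A.
Proof.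
move=> [_ _ [_ tI _]] aA Ax; apply/seteqP; split => y.
  move=> [A' [aA' A'x] A'y]; suff <- : A' = A by [].
  by apply: tI => //; exists x.
by move=> Ay; exists A.
Qed.

Lemma in_cell_partition (alpha : set (set T)) x : countable_partition alpha ->
  alpha (cell alpha x) /\ cell alpha x x.
Proof.
move=> ap; have [_ _ [cov _ _]] := ap.
have [A aA Ax] : cover alpha id x by rewrite cov.
by rewrite (cell_partition ap aA Ax).
Qed.

(** An injection f of [alpha] into the naturals places the cell A at index f(A) and the empty set at
    all other indices. *)
Lemma partition_cells_enum (alpha : set (set T)) : countable_partition alpha ->
  exists2 e, cells_enum alpha e &
    \sum_(i <oo) shannon_term mu (e i) <= shannon_entropy mu alpha.
Proof.
move=> ap; have [/countable_injP[f finj] malpha [cov tI ne]] := ap.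
pose e n := \bigcup_(A in [set A | alpha A /\ f A = n]) A.
have eE A : alpha A -> e (f A) = A.
  move=> aA; apply/seteqP; split => x; last by move=> Ax; exists A.
  move=> [A' [aA' ff] A'x]; suff <- : A' = A by [].
  by apply: finj => //; exact: mem_set.
have e0 n : (exists2 A, alpha A & e n = A /\ f A = n) \/ e n = set0.
  have [[A [aA fA]]|nA] := pselect (exists A, alpha A /\ f A = n).
    by left; exists A => //; rewrite -fA eE.
  right; rewrite /e (_ : [set _ | _] = set0) ?bigcup_set0//.
  by rewrite -subset0 => A aA; apply: nA; exists A.
have me n : measurable (e n).
  by have [[A aA [-> _]]|->] := e0 n; [exact: malpha|exact: measurable0].
exists e; first split => //.
- move=> i j _ _ [x [[A [aA <-] Ax] [A' [aA' <-] A'x]]].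
  by congr f; apply: tI => //; exists x.
- apply/seteqP; split => // x _; have [aC Cx] := in_cell_partition x ap.
  by exists (f (cell alpha x)) => //; rewrite eE.
- move=> i x [A [aA <-] Ax]; rewrite eE//.
  exact: cell_partition.
have s0 A : measurable A -> 0 <= shannon_term mu A.
  move=> mA; rewrite lee_fin -mulrN mulr_ge0 ?fine_ge0// oppr_ge0 ln_le0//.
  by rewrite -lee_fin fineK ?fin_num_measure// probability_le1.
rewrite nneseries_esumT; last by move=> n; exact: s0.
rewrite /shannon_entropy (@reindex_esum _ _ _ (f @` alpha) _ e); last first.
  split.
  - by move=> _ [A aA <-] /=; rewrite eE.
  - move=> _ _ /set_mem[A aA <-] /set_mem[A' aA' <-].
    by rewrite !eE// => ->.
  - by move=> A aA; exists (f A); [exists A|rewrite eE].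
(* Indices outside the image of f carry the empty set, whose Shannon term is 0. *)
rewrite [leRHS]esum_mkcond le_eqVlt; apply/orP; left; apply/eqP.
apply: eq_esum => n _; case: ifPn => // nf.
have [[A aA [_ fA]]|->] := e0 n; first by rewrite notin_setE in nf; case: nf; exists A.
by rewrite /shannon_term measure0/= mul0r oppr0.
Qed.

(** Intersections are indexed by codes of pairs. The exact inverse [pickle_inv] is defined on codes
    only, so no pair occurs at two indices and disjointness survives. *)
Lemma cells_enum_meet (alpha beta gamma : set (set T)) e e' :
  cells_enum alpha e -> cells_enum beta e' ->
  (forall x, cell gamma x = cell alpha x `&` cell beta x) ->
  exists e'', cells_enum gamma e''.
Proof.
move=> [me te Ue ce] [me' te' Ue' ce'] cellg.
exists (fun n => if (choice.pickle_inv n : option (nat * nat)) is Some ij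
                 then e ij.1 `&` e' ij.2 else set0).
split.
- by move=> n; case: choice.pickle_inv => // ij; exact: measurableI.
- move=> n m _ _; have := @choice.pickle_invK (nat * nat : countType)%type n.
  have := @choice.pickle_invK (nat * nat : countType)%type m.
  case: choice.pickle_inv => [[i j]|] /= mij; last by move=> ? [x []].
  case: choice.pickle_inv => [[i' j']|] /= nij; last by move=> [x []].
  move=> [x [[ix jx] [i'x j'x]]]; rewrite -mij -nij.
  have -> : i = i' by apply: te => //; exists x.
  by have -> : j = j' by apply: te' => //; exists x.
- apply/seteqP; split => // x _.
  have [i _ ix] : (\bigcup_i e i) x by rewrite Ue.
  have [j _ jx] : (\bigcup_i e' i) x by rewrite Ue'.
  by exists (choice.pickle (i, j)) => //; rewrite choice.pickleK_inv.
- move=> n x; case: choice.pickle_inv => // -[i j] /= [ix jx].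
  by rewrite cellg (ce _ _ ix) (ce' _ _ jx).
Qed.

Lemma cells_enum_trivial (alpha : set (set T)) : (forall x, cell alpha x = setT) ->
  cells_enum alpha (fun n => if n is 0%N then [set: T] else set0).
Proof.
move=> cellT; split.
- by case.
- by case=> [|i] [|j] _ _ // [x []].
- by apply/seteqP; split => // x _; exists 0%N.
- by case=> // x _; exact: cellT.
Qed.

End enumeration.

(** * Joins of translates *)

Section translates.
Context d (T : measurableType d) (R : realType) (mu : probability T R).
Context (Gam : groupType) (act : Gam -> T -> T).
Hypothesis act1 : forall x, act 1%g x = x.
Hypothesis actM : forall g h x, act (g * h)%g x = act g (act h x).
Hypothesis mact : forall g, measurable_fun setT (act g).
Hypothesis act_pmp : pmp mu act.
Variables (alpha A : set (set T)) (e : nat -> set T).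
Hypothesis alpha_part : countable_partition alpha.
Hypothesis alphae : cells_enum alpha e.
Hypothesis A_inv : invariant_subalgebra A act.
Local Open Scope ereal_scope.

Lemma measurable_act_preimage g D : measurable D -> measurable (act g @^-1` D).
Proof. by move=> mD; rewrite -[X in measurable X]setTI; exact: mact. Qed.

Lemma cell_translate g x :
  cell (translate alpha act g) x = act g @^-1` cell alpha (act g x).
Proof.
apply/seteqP; split => y.
  by move=> [_ [[B aB <-] Bx] By]; exists B.
by move=> [B [aB Bx] By]; exists (act g @^-1` B) => //; split => //; exists B.
Qed.

Lemma cells_enum_translate g :
  cells_enum (translate alpha act g) (fun i => act g @^-1` e i).
Proof.
have [me te Ue ce] := alphae; split.
- by move=> i; exact: measurable_act_preimage.
- by move=> i j _ _ [x [ix jx]]; apply: te => //; exists (act g x).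
- by rewrite -preimage_bigcup Ue preimage_setT.
- by move=> i x ix; rewrite cell_translate (ce _ _ ix).
Qed.

Lemma cell_join F x : cell (join_translates alpha act F) x =
  \bigcap_(g in [set` F]) cell (translate alpha act g) x.
Proof.
apply/seteqP; split => y.
  move=> [_ [[_ [c cP ->]] cx] cy] g gF; have gF' : g \in F by [].
  have [B aB Bc] := cP _ gF'.
  exists (c g); last exact: cy.
  by split; [exists B|exact: cx].
move=> xy; exists (\bigcap_(g in [set` F]) cell (translate alpha act g) x) => //.
have xx : (\bigcap_(g in [set` F]) cell (translate alpha act g) x) x.
  move=> g _; rewrite cell_translate.
  by have [] := in_cell_partition (act g x) alpha_part.
split => //; split; first by exists x.
exists (fun g => cell (translate alpha act g) x) => // g _.
rewrite cell_translate; exists (cell alpha (act g x)) => //.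
by have [] := in_cell_partition (act g x) alpha_part.
Qed.

Lemma cell_joinU1 m F x : cell (join_translates alpha act (m |` F)%fset) x =
  cell (translate alpha act m) x `&` cell (join_translates alpha act F) x.
Proof.
rewrite !cell_join; apply/seteqP; split => y.
  move=> xy; split; first by apply: xy; rewrite /= fset1U1.
  by move=> g gF; apply: xy; rewrite /= in_fsetU (_ : g \in F) ?orbT.
move=> [my Fy] g /=; rewrite in_fsetU in_fset1 => /orP[/eqP->//|gF].
exact: Fy.
Qed.

Lemma cell_join0 x : cell (join_translates alpha act fset0) x = setT.
Proof. by rewrite cell_join; apply/seteqP; split. Qed.

Lemma cells_enum_join F : exists e', cells_enum (join_translates alpha act F) e'.
Proof.
elim/finSet_rect: F => F IH; have [->|[m mF]] := fset_0Vmem F.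
  by eexists; apply: cells_enum_trivial => x; exact: cell_join0.
have [e' Fe'] := IH _ (fproperD1 mF).
rewrite -(fsetD1K mF); apply: cells_enum_meet (cells_enum_translate m) Fe' _.
exact: cell_joinU1.
Qed.

Definition past_algebra (S : set Gam) :=
  sigma_join (sigma_translates alpha act S) A.

Lemma subalgebra_A : subalgebra A.
Proof. by have [sA mA _] := A_inv. Qed.

Lemma translate_measurable g D : translate alpha act g D -> measurable D.
Proof.
move=> [B aB <-]; apply: measurable_act_preimage.
by have [_ + _] := alpha_part; apply.
Qed.

(** An induction principle through both nested generated sigma-algebras at once. *)
Lemma past_algebra_ind (S : set Gam) (P : set (set T)) :
  sigma_algebra setT P ->
  (forall g D, S g -> translate alpha act g D -> P D) -> A `<=` P ->
  past_algebra S `<=` P.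
Proof.
move=> sP tP AP; apply: smallest_sub => // D [|/AP//].
by apply: smallest_sub => // {}D [g Sg gD]; exact: tP gD.
Qed.

Lemma past_algebra_translate (S : set Gam) g D :
  S g -> translate alpha act g D -> past_algebra S D.
Proof.
move=> Sg gD; apply: sub_sigma_algebra; left.
by apply: sub_sigma_algebra; exists g.
Qed.

Lemma past_algebra_A (S : set Gam) : A `<=` past_algebra S.
Proof. by move=> D AD; apply: sub_sigma_algebra; right. Qed.

Lemma sigma_algebra_past (S : set Gam) : sigma_algebra setT (past_algebra S).
Proof. exact: smallest_sigma_algebra. Qed.

Lemma subalgebra_past (S : set Gam) : subalgebra (past_algebra S).
Proof.
split; first exact: sigma_algebra_past.
apply: past_algebra_ind.
- exact: sigma_algebra_measurable.
- by move=> g D _; exact: translate_measurable.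
- exact: subalgebra_A.2.
Qed.

Lemma past_algebraS (S S' : set Gam) : S `<=` S' ->
  past_algebra S `<=` past_algebra S'.
Proof.
move=> SS'; apply: past_algebra_ind; first exact: sigma_algebra_past.
- by move=> g D /SS'; exact: past_algebra_translate.
- exact: past_algebra_A.
Qed.

(** For a left action, pulling act(h)^-1 B back along g gives act(h g)^-1 B: translation acts on
    pasts by right multiplication. Invariance of [A] handles the remaining generators. *)
Lemma past_algebra_preimage (S S' : set Gam) g :
  (forall h, S h -> S' (h * g)%g) ->
  forall D, past_algebra S D -> past_algebra S' (act g @^-1` D).
Proof.
move=> SS'; apply: (@past_algebra_ind _ [set D | past_algebra S' (act g @^-1` D)]).
- have [P0 PC PU] := sigma_algebra_past S'; split => /=.
  + by rewrite preimage_set0.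
  + by move=> D SD; rewrite setTD preimage_setC -setTD; exact: PC.
  + by move=> D SD; rewrite preimage_bigcup; exact: PU.
- move=> h _ Sh [B aB <-] /=; apply: (past_algebra_translate (SS' _ Sh)).
  by exists B => //; apply/seteqP; split => x /=; rewrite actM.
- move=> D AD /=; apply: past_algebra_A; have [_ _ +] := A_inv; exact.
Qed.

Definition past_entropy (S : set Gam) := cond_entropy mu alpha (past_algebra S).

(** The map [act g] preserves [mu], pulls [alpha] back to its translate by g, and pulls the algebra
    of S g^-1 back exactly onto that of S; the converse inclusion uses the inverse of g. *)
Lemma cond_entropy_translate g (S : set Gam) :
  cond_entropy mu (translate alpha act g) (past_algebra S) =
  past_entropy [set h | S (h * g)%g].
Proof.
rewrite /past_entropy; set S' := [set h | _].
apply: (@cond_entropy_pmp _ _ _ _ (act g) (mact g) _ _ _ (subalgebra_past _)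
  (subalgebra_past _)) alphae (cells_enum_translate g).
- by move=> D mD; exact: act_pmp.
- exact: past_algebra_preimage.
- move=> D SD; exists (act g^-1%g @^-1` D).
    apply: past_algebra_preimage SD => h Sh.
    by rewrite /S'/= -mulgA mulVg mulg1.
  by apply/seteqP; split => x /=; rewrite -actM mulVg act1.
Qed.

(** The chain rule with B = A and C the join of alpha^F and A. Its trace hypothesis holds because
    inside one cell of alpha^F every generator from alpha^F is everything or nothing. *)
Lemma join_entropyU1 m F :
  cond_entropy mu (join_translates alpha act (m |` F)%fset) A =
  cond_entropy mu (join_translates alpha act F) A +
  cond_entropy mu (translate alpha act m) (past_algebra [set` F]).
Proof.
have [e1 Ue1] := cells_enum_join (m |` F)%fset.
have [e2 Fe2] := cells_enum_join F.
have sP := subalgebra_past [set` F].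
have translate_cases i g D : g \in F -> translate alpha act g D ->
    D `&` e2 i = setT `&` e2 i \/ D `&` e2 i = set0 `&` e2 i.
  move=> gF [B aB <-].
  have [[x [ix Bx]]|ne] := pselect (exists x, e2 i x /\ B (act g x)).
    left; rewrite setTI; apply/setIidr => y iy.
    have [_ _ _ ce] := Fe2; have : cell (join_translates alpha act F) x y.
      by rewrite (ce _ _ ix).
    rewrite cell_join => /(_ g gF).
    by rewrite cell_translate /= (cell_partition alpha_part aB Bx).
  right; rewrite set0I -subset0 => x [Bx ix]; apply: ne; by exists x.
apply: (@cond_entropy_chain _ _ _ _ _ _ subalgebra_A sP (@past_algebra_A _)
  _ _ _ _ _ _ (cells_enum_translate m) Fe2 Ue1).
- exact: cell_joinU1.
- move=> j; have [[x jx]|ne] := pselect (exists x, e2 j x); last first.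
    rewrite (_ : e2 j = set0); first by case: sP.1.
    by rewrite -subset0 => x jx; apply: ne; exists x.
  have [_ _ _ ce] := Fe2; rewrite -(ce _ _ jx) cell_join.
  rewrite -subalgebra_measurable//; apply: fin_bigcap_measurable => // g gF.
  rewrite subalgebra_measurable//; apply: (past_algebra_translate gF).
  rewrite cell_translate; exists (cell alpha (act g x)) => //.
  by have [] := in_cell_partition (act g x) alpha_part.
(* The sets whose trace on the cell [e2 j] is also the trace of a set of [A] form a sigma-algebra;
   it contains [A] and, by [translate_cases], the translates. *)
- move=> j; have [A0 AC AU] := subalgebra_A.1.
  have AT : A setT by rewrite -(setD0 setT); exact: AC.
  apply: past_algebra_ind.
  + split; first by exists set0.
    * move=> D [D' AD' DD']; exists (setT `\` D'); first exact: AC.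
      rewrite !setTD; apply/seteqP; split => x [nD jx]; split => //.
        by move=> D'x; have : (D' `&` e2 j) x by []; rewrite -DD' => -[].
      by move=> Dx; have : (D `&` e2 j) x by []; rewrite DD' => -[].
    * move=> D /= SD.
      have /choice[D' D'P] n : exists D', A D' /\ D n `&` e2 j = D' `&` e2 j.
        by have [D' AD' DD'] := SD n; exists D'.
      exists (\bigcup_n D' n); first by apply: AU => n; case: (D'P n).
      rewrite !setI_bigcupl; apply: eq_bigcupr => n _.
      by case: (D'P n).
  + move=> g D gF gD; have [->|->] := translate_cases j g D gF gD.
      by exists setT.
    by exists set0.
  + by move=> D AD; exists D.
Qed.

(** Here [r h g] reads: g precedes h. The element found is the last one of the list, which is split
    off in the chain rule. *)
Lemma max_in_seq (r : Gam -> Gam -> bool) (s : seq Gam) :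
  (forall g h, r h g -> forall k, r g k -> r h k) ->
  (forall g h, g != h -> r h g \/ r g h) -> s != [::] ->
  exists2 m, m \in s & forall g, g \in s -> g != m -> r m g.
Proof.
move=> tr tot; elim: s => // a [_ _|b s IH _].
  by exists a; rewrite ?mem_head// => g; rewrite inE => /eqP ->; rewrite eqxx.
have [//|m ms mmax] := IH; have [am|am] := eqVneq a m.
  exists m; first by rewrite in_cons ms orbT.
  by move=> g; rewrite in_cons => /predU1P[->|]; [rewrite am eqxx|exact: mmax].
have [rma|ram] := tot _ _ am.
  exists m; first by rewrite in_cons ms orbT.
  by move=> g; rewrite in_cons => /predU1P[->//|]; exact: mmax.
exists a; first exact: mem_head.
move=> g; rewrite in_cons => /predU1P[->|gs _]; first by rewrite eqxx.
by have [->//|gm] := eqVneq g m; apply: tr ram _ _; exact: mmax.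
Qed.

(** Induction removing the last element m of F. All other elements of F precede m, so the chain rule
    term of m is the one wanted; and m precedes no g in F, so its removal leaves the terms of the
    others unchanged. *)
Lemma join_entropy_sum (r : Gam -> Gam -> bool) F :
  (forall g, ~~ r g g) ->
  (forall g h, r h g -> forall k, r g k -> r h k) ->
  (forall g h, g != h -> r h g \/ r g h) ->
  cond_entropy mu (join_translates alpha act F) A =
  \sum_(g <- F) past_entropy [set h | (h * g)%g \in F /\ r g (h * g)%g].
Proof.
move=> irr tr tot; elim/finSet_rect: F => F IH.
have [->|F0] := eqVneq F fset0.
  rewrite big_seq_fset0.
  have triv := cells_enum_trivial cell_join0.
  apply/eqP; rewrite eq_le (cond_entropy_ge0 mu subalgebra_A triv) andbT.
  rewrite (le_trans (cond_entropy_le_shannon mu subalgebra_A triv))//.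
  rewrite eseries0// => -[|i] _ _; rewrite /shannon_term.
    by rewrite (@probability_setT _ _ _ mu)/= ln1 mulr0 oppr0.
  by rewrite measure0/= mul0r oppr0.
have [m mF mmax] := max_in_seq tr tot F0.
rewrite (big_fsetD1 m mF)/= -{1}(fsetD1K mF) join_entropyU1 IH ?fproperD1//.
rewrite addeC cond_entropy_translate; congr (past_entropy _ + _).
  apply/seteqP; split => h /=; rewrite in_fsetD1.
    by move=> /andP[hm hF]; split => //; exact: mmax.
  move=> [hF rm]; rewrite hF andbT; apply: contraTN rm => /eqP ->.
  exact: irr.
rewrite big_seq [RHS]big_seq; apply: eq_bigr => g; rewrite in_fsetD1 => /andP[gm gF].
congr past_entropy; apply/seteqP; split => h /=; rewrite in_fsetD1.
  by move=> [/andP[_ hF] rg].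
move=> [hF rg]; rewrite hF andbT; split => //; apply/eqP => hm.
(* If m preceded g, then with g preceding m transitivity would make m precede itself. *)
have := irr m; rewrite -{2}hm => /negP; apply; apply: tr (mmax _ gF gm) _ _.
exact: rg.
Qed.

End translates.

(** * Random pasts *)

Lemma g_sigma_algebra_measurable (U V : pointedType) (GU : set (set U))
    (GV : set (set V)) (f : U -> V) : (forall D, GV D -> GU (f @^-1` D)) ->
  measurable_fun [set: g_sigma_algebraType GU]
    (f : g_sigma_algebraType GU -> g_sigma_algebraType GV).
Proof.
move=> fG.
apply: (@measurability _ _ _ (g_sigma_algebraType GV) _ _ GV) => //.
move=> _ [D GD <-]; rewrite setTI; apply: sub_sigma_algebra.
exact: fG.
Qed.

Section random_past_measurability.
Context (Gam : groupType).
Implicit Types (S : subsets Gam) (K : {fset Gam}).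

Lemma proj_past_continuous (g : Gam) :
  continuous (fun Phi : past_functions Gam => Phi g : subsets Gam).
Proof.
exact: (@proj_continuous Gam (fun _ => subsets Gam) g).
Qed.

Lemma proj_subset_continuous (g : Gam) :
  continuous (fun S : subsets Gam => S g : bool).
Proof.
exact: (@proj_continuous Gam (fun _ => bool) g).
Qed.

Lemma right_translate_continuous (g : Gam) :
  continuous (fun Phi : past_functions Gam =>
    right_translate (Phi 1%g) g : subsets Gam).
Proof.
move=> Phi.
have Phi_filter : Filter ((fun Psi : past_functions Gam =>
    right_translate (Psi 1%g) g : subsets Gam) @ Phi).
  exact: (fmap_filter _ (nbhs_filter Phi)).
apply/(@pointwise_cvgP (discrete_topology Gam) bool _ _ Phi_filter) => k.
apply: (@continuous_comp (past_functions Gam) (subsets Gam) bool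
  (fun Phi => Phi 1%g) (fun S => S (k * g^-1)%g)).
- exact: proj_past_continuous.
- exact: proj_subset_continuous.
Qed.

Lemma finite_coordinates_nbhs S K :
  nbhs S [set S' : subsets Gam | forall k, k \in K -> S' k = S k].
Proof.
elim/finSet_rect: K => K IH; have [->|[m mK]] := fset_0Vmem K.
  by apply: filterS filterT => S' _ k; rewrite in_fset0.
have nm : nbhs S [set S' : subsets Gam | S' m = S m].
  apply: (@proj_subset_continuous m S [set b | b = S m]).
  exact: discrete_set1.
apply: filterS (filterI nm (IH _ (fproperD1 mK))) => S' /= [Sm SK] k kK.
have [->//|km] := eqVneq k m.
by apply: SK; rewrite in_fsetD1 km.
Qed.

(** A function of finitely many discrete coordinates is locally constant, so every preimage is open,
    whatever the sigma-algebra on the target. *)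
Lemma finite_coordinates_measurable d (Y : measurableType d)
    (f : subsets Gam -> Y) K :
  (forall S S', (forall k, k \in K -> S' k = S k) -> f S' = f S) ->
  measurable_fun [set: borel (subsets Gam)] f.
Proof.
move=> fK _ V _; rewrite setTI; apply: sub_sigma_algebra.
rewrite openE => S fS; apply: filterS (finite_coordinates_nbhs S K) => S' SS'.
by rewrite /preimage/= (fK _ _ SS').
Qed.

Context (R : realType) (P : probability (borel (past_functions Gam)) R).
Hypothesis P_irp : invariant_random_past P.

(** Condition (iv) says that two image measures of [P] agree on measurable sets; both sides are
    integrals against these images. *)
Lemma integral_past_translate (f : subsets Gam -> \bar R) (g : Gam) :
  measurable_fun [set: borel (subsets Gam)] f -> (forall S, 0 <= f S)%E ->
  (\int[P]_Phi f (Phi g) = \int[P]_Phi f (right_translate (Phi 1%g) g))%E.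
Proof.
move=> mf f0.
have m1 : measurable_fun [set: borel (past_functions Gam)]
    (fun Phi => Phi g : borel (subsets Gam)).
  apply: g_sigma_algebra_measurable.
  by have /continuousP := @proj_past_continuous g.
have m2 : measurable_fun [set: borel (past_functions Gam)]
    (fun Phi => right_translate (Phi 1%g) g : borel (subsets Gam)).
  apply: g_sigma_algebra_measurable.
  by have /continuousP := @right_translate_continuous g.
have [_ _ _ inv] := P_irp.
transitivity (\int[pushforward P (fun Phi : borel (past_functions Gam) =>
    Phi g : borel (subsets Gam))]_S f S)%E.
  by rewrite (ge0_integral_pushforward m1).
transitivity (\int[pushforward P (fun Phi : borel (past_functions Gam) =>
    right_translate (Phi 1%g) g : borel (subsets Gam))]_S f S)%E; last first.
  by rewrite (ge0_integral_pushforward m2).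
by apply: eq_measure_integral => D mD _; exact: inv.
Qed.

End random_past_measurability.

(** * Finite exhaustions and boundary counts *)

Lemma countable_exhaustion (I : choiceType) : countable [set: I] ->
  exists K : nat -> {fset I}, (forall n, {subset K n <= K n.+1}) /\
    forall i, exists n, i \in K n.
Proof.
move=> /countable_injP[f finj].
have fin n : finite_set [set i | (f i < n)%N].
  apply: (@finite_preimage _ _ `I_n f); last exact: finite_II.
  by move=> i j _ _; apply: finj; rewrite inE.
exists (fun n => fset_set [set i | (f i < n)%N]); split.
  by move=> n i; rewrite !in_fset_set// !inE /=; exact: ltnW.
by move=> i; exists (f i).+1; rewrite in_fset_set// inE /=.
Qed.

(** If K g is not contained in F, some k in K moves g out of F. Left multiplication by k is
    injective, so the elements of F moved out by k are as many as those of kF outside F; summing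
    over k gives the bound. *)
Lemma boundary_count_le (Gam : groupType) (F K : {fset Gam}) :
  (\sum_(g <- F) ~~ all (fun k => (k * g)%g \in F) K <=
   \sum_(k <- K) #|` ([fset (k * x)%g | x in F] `\` F)%fset|)%N.
Proof.
have card k : #|` ([fset (k * x)%g | x in F] `\` F)%fset| =
    (\sum_(g <- F) ((k * g)%g \notin F))%N.
  rewrite (_ : (_ `\` _)%fset =
      [fset (k * x)%g | x in [fset x in F | (k * x)%g \notin F]%fset]%fset).
    rewrite card_imfset; last exact: mulgI.
    rewrite (_ : size _ = #|` [fset x in F | (k * x)%g \notin F]%fset|)//.
    rewrite card_fset_sum1 -big_fset_condE big_mkcond/=.
    by apply: eq_bigr => x _; case: (_ \notin _).
  apply/fsetP => y; rewrite in_fsetD; apply/andP/imfsetP => /=.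
    move=> [yF /imfsetP[x /= xF yx]]; exists x => //.
    by rewrite !inE/= xF -yx.
  move=> [x]; rewrite !inE/= => /andP[xF kxF] ->; split => //.
  by apply/imfsetP; exists x.
under [leqRHS]eq_bigr do rewrite card.
rewrite exchange_big/=; apply: leq_sum => g _.
case: (boolP (all _ _)) => //= /allPn[k kK kgF].
by rewrite (big_rem k)//= kgF leq_addr.
Qed.

(** * Averaging over the random past *)

Section entropy_of_past.
Context d (T : measurableType d) (R : realType) (mu : probability T R).
Context (Gam : groupType) (act : Gam -> T -> T).
Hypothesis Gam_countable : countable [set: Gam].
Hypothesis act1 : forall x, act 1%g x = x.
Hypothesis actM : forall g h x, act (g * h)%g x = act g (act h x).
Hypothesis mact : forall g, measurable_fun setT (act g).
Hypothesis act_pmp : pmp mu act.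
Variables (alpha A : set (set T)).
Hypothesis alpha_part : countable_partition alpha.
Hypothesis alpha_fin : (shannon_entropy mu alpha < +oo)%E.
Hypothesis A_inv : invariant_subalgebra A act.
Context (P : probability (borel (past_functions Gam)) R).
Hypothesis P_irp : invariant_random_past P.
Local Open Scope ereal_scope.

Let G (S : set Gam) := past_entropy mu act alpha A S.

Let sub_past S := subalgebra_past mact alpha_part A_inv S.

Lemma past_entropy_ge0 S : 0 <= G S.
Proof.
have [e ae _] := partition_cells_enum mu alpha_part.
exact: (cond_entropy_ge0 mu (sub_past S) ae).
Qed.

Lemma past_entropy_le_shannon S : G S <= shannon_entropy mu alpha.
Proof.
have [e ae] := partition_cells_enum mu alpha_part.
apply: le_trans; exact: (cond_entropy_le_shannon mu (sub_past S) ae).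
Qed.

Lemma past_entropy_antitone S S' : S `<=` S' -> G S' <= G S.
Proof.
have [e ae _] := partition_cells_enum mu alpha_part.
move=> SS'; apply: (cond_entropy_antitone mu ae) => //.
exact: past_algebraS.
Qed.

(** The algebras of the finite pasts increase and together generate the algebra of S, so
    [cond_entropy_cvg] applies. *)
Lemma past_entropy_cvg (K : nat -> {fset Gam}) S :
  (forall n, {subset K n <= K n.+1}) -> (forall g, exists n, g \in K n) ->
  G [set h | h \in K n /\ S h] @[n --> \oo] --> G S.
Proof.
move=> ndK KT; have [e ae es] := partition_cells_enum mu alpha_part.
apply: (cond_entropy_cvg ae (le_lt_trans es alpha_fin)) => //.
- by move=> n; apply: past_algebraS => h /= [/ndK].
- by move=> n; apply: past_algebraS => h /= [].
- apply: past_algebra_ind; first exact: smallest_sigma_algebra.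
  + move=> g D Sg gD; have [n gK] := KT g.
    apply: sub_sigma_algebra; exists n => //.
    exact: past_algebra_translate gD.
  + by move=> D AD; apply: sub_sigma_algebra; exists 0%N => //; exact: past_algebra_A.
Qed.

(** The entropy is a pointwise limit of functions depending on finitely many coordinates of S, each
    of which is measurable. *)
Lemma measurable_past_entropy (U : set Gam) : measurable_fun
  [set: borel (subsets Gam)] (fun S => G [set h | U h /\ S h]).
Proof.
have [K [ndK KT]] := countable_exhaustion Gam_countable.
apply: (emeasurable_fun_cvg
  (fun n (S : borel (subsets Gam)) => G [set h | h \in K n /\ (U h /\ S h)])).
- move=> n; apply: (@finite_coordinates_measurable _ _ _ _ (K n)) => S S' SS'.
  by congr G; apply/seteqP; split => h /= [hK [Uh Sh]]; split => //; split => //;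
    move: Sh; rewrite SS'.
- by move=> S _; exact: past_entropy_cvg.
Qed.

Lemma measurable_proj_past (g : Gam) : measurable_fun
  [set: borel (past_functions Gam)] (fun Phi => Phi g : borel (subsets Gam)).
Proof.
apply: g_sigma_algebra_measurable.
by have /continuousP := @proj_past_continuous Gam g.
Qed.

(** The window U interpolates between the quantities compared: U = F g^-1 is the term of g in the
    entropy of alpha^F, a finite U gives the upper bounds, and U = [setT] gives the right-hand side
    of the theorem. *)
Definition mean_entropy (U : set Gam) :=
  \int[P]_Phi G [set h | U h /\ (Phi : past_functions Gam) 1%g h].

Let measurable_mean U : measurable_fun [set: borel (past_functions Gam)]
  (fun Phi : past_functions Gam => G [set h | U h /\ Phi 1%g h]).
Proof.
exact: (measurableT_comp (measurable_past_entropy U) (measurable_proj_past 1%g)).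
Qed.

Lemma mean_entropy_ge0 U : 0 <= mean_entropy U.
Proof. by apply: integral_ge0 => Phi _; exact: past_entropy_ge0. Qed.

Lemma integral_prob_cst (c : \bar R) : \int[P]_x c = c.
Proof.
rewrite (integral_cst P measurableT c) [X in _ * X](@probability_setT _ _ _ P).
by rewrite mule1.
Qed.

Lemma mean_entropy_le_shannon U : mean_entropy U <= shannon_entropy mu alpha.
Proof.
rewrite -[leRHS]integral_prob_cst; apply: ge0_le_integral => //.
- by move=> Phi _; exact: past_entropy_ge0.
- by move=> Phi _; exact: past_entropy_le_shannon.
Qed.

Lemma mean_entropy_antitone U V : U `<=` V -> mean_entropy V <= mean_entropy U.
Proof.
move=> UV; apply: ge0_le_integral => //.
- by move=> Phi _; exact: past_entropy_ge0.
- by move=> Phi _; apply: past_entropy_antitone => h /= [/UV].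
Qed.

Lemma mean_entropy_cvg (K : nat -> {fset Gam}) :
  (forall n, {subset K n <= K n.+1}) -> (forall g, exists n, g \in K n) ->
  mean_entropy [set` K n] @[n --> \oo] --> mean_entropy setT.
Proof.
move=> ndK KT.
have [] := @dominated_convergence _ _ _ P setT measurableT
  (fun n (Phi : past_functions Gam) => G [set h | h \in K n /\ Phi 1%g h])
  (fun Phi : past_functions Gam => G [set h | setT h /\ Phi 1%g h])
  (cst (shannon_entropy mu alpha)).
- by move=> n; exact: measurable_mean [set` K n].
- exact: measurable_mean setT.
- apply: aeW => Phi _.
  rewrite (_ : [set h | setT h /\ _] = [set h | Phi 1%g h]).
    exact: past_entropy_cvg.
  by apply/seteqP; split => h //= [].
- have s0 : 0 <= shannon_entropy mu alpha.
    exact: le_trans (past_entropy_ge0 setT) (past_entropy_le_shannon setT).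
  have sfin : shannon_entropy mu alpha \is a fin_num by rewrite ge0_fin_numE.
  rewrite -(fineK sfin); exact: finite_measure_integrable_cst.
- apply: aeW => Phi n _; rewrite gee0_abs; last exact: past_entropy_ge0.
  exact: past_entropy_le_shannon.
by move=> _ _; exact.
Qed.

(** The left side does not depend on the past, so [join_entropy_sum], valid for almost every past,
    may be averaged. By linearity each term involves the law of a single Phi(g), which condition
    (iv) replaces by that of Phi(1) g. *)
Lemma join_entropy_mean (F : {fset Gam}) :
  cond_entropy mu (join_translates alpha act F) A =
  \sum_(g <- F) mean_entropy [set h | (h * g)%g \in F].
Proof.
have [e ae _] := partition_cells_enum mu alpha_part.
have [P1 P2 P3 _] := P_irp.
rewrite -[LHS]integral_prob_cst.
pose f g (Phi : past_functions Gam) :=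
  G [set h | (h * g)%g \in F /\ Phi g (h * g)%g].
pose psi g (S : subsets Gam) := G [set h | (h * g)%g \in F /\ S (h * g)%g].
have mpsi g : measurable_fun [set: borel (subsets Gam)] (psi g).
  apply: (@finite_coordinates_measurable _ _ _ _ F) => S S' SS'.
  by congr G; apply/seteqP; split => h /= [hF Sh]; split => //;
    move: Sh; rewrite SS'.
have mf g : measurable_fun [set: borel (past_functions Gam)] (f g).
  exact: (measurableT_comp (mpsi g) (measurable_proj_past g)).
have f0 g Phi : 0 <= f g Phi by exact: past_entropy_ge0.
transitivity (\int[P]_Phi (\sum_(g <- F) f g Phi)).
  apply: ae_eq_integral => //; first exact: emeasurable_sum.
  have := @filterI _ _ (ae_filter_ringOfSetsType P) _ _ P1
    (@filterI _ _ (ae_filter_ringOfSetsType P) _ _ P2 P3).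
  apply: ae_mono => Phi [irr [tr tot]] _.
  exact: (join_entropy_sum act1 actM mact act_pmp alpha_part ae A_inv).
rewrite (@ge0_integral_sum _ _ _ P setT measurableT Gam f mf
  (fun g Phi _ => f0 g Phi)).
apply: eq_bigr => g _.
transitivity (\int[P]_Phi psi g (right_translate ((Phi : past_functions Gam) 1%g) g)).
  apply: (integral_past_translate P_irp) => // S; exact: past_entropy_ge0.
(* The two translations by g cancel: (h g) g^-1 = h. *)
apply: eq_integral => Phi _; congr G; apply/seteqP.
by split => h /=; rewrite /right_translate -mulgA mulgV mulg1.
Qed.

End entropy_of_past.

(** * The limit along the Folner sequence *)

Lemma sum_const_seq (V : nmodType) I (r : seq I) (x : V) :
  \sum_(i <- r) x = x *+ size r.
Proof. by rewrite big_const_seq count_predT iter_addr addr0. Qed.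

Theorem theorem3p1 (R : realType) (Gam : groupType)
    (Gam_countable : countable [set: Gam])
    (Gam_amenable : amenable R Gam)
    (X : pointedMetricType R) (X_compact : compact [set: X])
    (mu : probability (borel X) R)
    (act : Gam -> X -> X) (act_homeo : homeo_action act)
    (act_pmp : pmp mu act)
    (P : probability (borel (past_functions Gam)) R)
    (P_irp : invariant_random_past P)
    (alpha : set (set (borel X))) (alpha_part : countable_partition alpha)
    (alpha_fin : (shannon_entropy mu alpha < +oo)%E)
    (A : set (set (borel X))) (A_inv : invariant_subalgebra A act)
    (F : nat -> {fset Gam}) (F_folner : folner R F) :
  cvgn (entropy_rate mu alpha A act F) /\
  KS_entropy mu alpha A act F =
  (\int[P]_Phi cond_entropy mu alpha
     (sigma_join
        (sigma_translates alpha act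
           [set h : Gam | Phi 1%g h]) A))%E.
Proof.
have [act1 actM act_cont] := act_homeo.
have mact g : measurable_fun [set: borel X] (act g : borel X -> borel X).
  apply: g_sigma_algebra_measurable.
  by have /continuousP := act_cont g.
have [F0 F_inv] := F_folner.
pose E (U : set Gam) := mean_entropy mu act alpha A P U.
have E0 U : (0 <= E U)%E by exact: mean_entropy_ge0.
have Es U : (E U <= shannon_entropy mu alpha)%E by exact: mean_entropy_le_shannon.
have Efin U : E U \is a fin_num by rewrite ge0_fin_numE// (le_lt_trans (Es U)).
have Eanti U V : U `<=` V -> (E V <= E U)%E by exact: mean_entropy_antitone.
have sfin : shannon_entropy mu alpha \is a fin_num.
  by rewrite ge0_fin_numE// (le_trans (E0 setT)).
pose s := fine (shannon_entropy mu alpha).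
have s0 : 0 <= s by rewrite fine_ge0// (le_trans (E0 setT)).
pose e U := fine (E U).
have eE U : E U = (e U)%:E by rewrite fineK.
have es U : e U <= s by rewrite fine_le.
have eanti U V : U `<=` V -> e V <= e U.
  move=> UV; apply: fine_le; [exact: Efin|exact: Efin|exact: Eanti].
pose N i := #|` F i|%:R : R.
have N0 i : 0 < N i by rewrite ltr0n cardfs_gt0.
pose x i := (\sum_(g <- F i) e [set h | (h * g)%g \in F i]) / N i.
have rateE : entropy_rate mu alpha A act F = EFin \o x.
  apply/funext => i; rewrite /entropy_rate /x /=.
  rewrite (join_entropy_mean (T := borel X) act1 actM mact act_pmp alpha_part
    A_inv P_irp).
  by rewrite EFinM -sumEFin; congr (_ * _)%E; apply: eq_bigr => g _; exact: eE.
have [K [ndK KT]] := countable_exhaustion Gam_countable.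
have lower i : e setT <= x i.
  rewrite ler_pdivlMr// /N mulr_natr -sum_const_seq.
  by apply: ler_sum => g _; exact: eanti.
pose ratio k i := #|` ([fset (k * x)%g | x in F i] `\` F i)%fset|%:R / N i.
(* An element g with K_n g inside F_i contributes at most e(K_n), by monotonicity; any other
   contributes at most s. The proportion of the latter is bounded by the sum of the Folner ratios
   over K_n. *)
have upper n i : x i <= e [set` K n] + s * \sum_(k <- K n) ratio k i.
  rewrite ler_pdivrMr// mulrDl.
  apply: (@le_trans _ _ (\sum_(g <- F i) (e [set` K n] +
      s * (~~ all (fun k => (k * g)%g \in F i) (K n))%:R))).
    apply: ler_sum => g _; case: (boolP (all _ _)) => [/allP Kg|_] /=.
      by rewrite mulr0 addr0; apply: eanti => h /= /Kg.
    by rewrite mulr1 (le_trans (es _))// lerDr fine_ge0.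
  rewrite big_split/= sum_const_seq -mulr_natr lerD2l -mulr_sumr -mulrA.
  rewrite ler_wpM2l// mulr_suml -natr_sum.
  rewrite [leRHS](eq_bigr (fun k => #|` ([fset (k * x)%g | x in F i] `\` F i)%fset|%:R)).
    by rewrite -natr_sum ler_nat boundary_count_le.
  by move=> k _; rewrite divfK// gt_eqF.
have ratio0 n : \sum_(k <- K n) ratio k i @[i --> \oo] --> (0 : R).
  elim: (K n : seq Gam) => [|k r IH].
    under eq_fun do rewrite big_nil.
    exact: cvg_cst.
  under eq_fun do rewrite big_cons.
  have := cvgD (F_inv k) IH; rewrite addr0; exact.
have eK : e [set` K n] @[n --> \oo] --> e setT.
  have := mean_entropy_cvg (T := borel X) (P := P)
    Gam_countable mact alpha_part alpha_fin A_inv ndK KT.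
  by rewrite -/(E setT) eE => /fine_cvgP[].
have xc : x @ \oo --> e setT.
  apply/cvgrPdist_le => eps eps0.
  have eps20 : 0 < eps / 2 by rewrite divr_gt0.
  (* The window K_n is fixed first, within eps / 2 of the limit; only then is i taken large, so that
     the boundary term of this K_n is below eps / 2. *)
  have /cvgrPdist_le/(_ _ eps20)[n _ /(_ n (leqnn n)) Kn] := eK.
  have : s * \sum_(k <- K n) ratio k i @[i --> \oo] --> s * 0.
    by apply: cvgMr; exact: ratio0.
  rewrite mulr0 => /cvgrPdist_le/(_ _ eps20)[i0 _ Hi].
  exists i0 => // i /= /Hi; rewrite sub0r normrN => Ri.
  rewrite distrC ger0_norm ?subr_ge0// lerBlDl.
  apply: (le_trans (upper n i)).
  have h1 := le_trans (ler_norm _) Ri.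
  rewrite distrC in Kn; have h2 := le_trans (ler_norm _) Kn.
  rewrite lerBlDl in h2; have := lerD h2 h1.
  rewrite -addrA -splitr; exact.
have rate_cvg : entropy_rate mu alpha A act F @ \oo --> E setT.
  by rewrite rateE eE; apply: cvg_EFin => //; exact: nearW.
split; first by apply/cvg_ex; exists (E setT).
transitivity (E setT); first exact: (cvg_lim (@ereal_hausdorff R) rate_cvg).
apply: eq_integral => Phi _; rewrite /past_entropy /past_algebra.
congr cond_entropy; congr (sigma_join (sigma_translates _ _ _) _).
by apply/seteqP; split => h //= [].
Qed.
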